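(* Let $u_1,u_2,u_3\in\mathbb{K}[T_1,T_2]$ be homogeneous of degree $d=2k>3$ without common factors, such that $\phi=(u_1:u_2:u_3)$ is a proper parameterization of a plane curve $C=V(E)$ of degree $d$, $E\in\mathbb{K}[X_1,X_2,X_3]$ irreducible, that is parameterizable by conics and not by lines. Let $(F_1,F_2)$ be the pair of forms of degree $2$ in $\mathbb{K}[X_1,X_2,X_3]$ without common factors defining the inverse of $\phi$. In this case $\mathrm{Syz}(I)$ has a $\mathbb{K}[T_1,T_2]$-basis $\{p_{k,1}(T,X),q_{k,1}(T,X)\}$ whose elements both have $T$-degree $k$. Let $Q(T,X)\in\mathcal{K}_{k-1,2}$ be a nonzero element such that $Q(F_1(X),F_2(X),X)=E(X)$ up to a nonzero constant in $\mathbb{K}$ (such $Q$ exists). Set $P_{k-1}(T,X):=Q(T,X)$ and, for $j=0,1,\ldots,k-2$, write (in any way, with bihomogeneous coefficients) $$P_{k-1-j}(T,X)=A_{k-j}(T,X)\,T_1+B_{k-j}(T,X)\,T_2$$ and set $$P_{k-j-2}(T,X):=A_{k-j}(T,X)\,F_1(X)+B_{k-j}(T,X)\,F_2(X).$$ Then $$J:=\{T_1F_2(X)-T_2F_1(X),\ P_0(T,X),\ldots,P_{k-1}(T,X),\ p_{k,1}(T,X),\ q_{k,1}(T,X)\}$$ is a minimal set of generators of the ideal $\mathcal{K}$.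
   Context: $\mathbb{K}$ is an algebraically closed field, $T=(T_1,T_2)$, $X=(X_1,X_2,X_3)$, $I=\langle u_1,u_2,u_3\rangle\subset\mathbb{K}[T]$. The ideal $\mathcal{K}\subset\mathbb{K}[T][X]$ is the kernel of the $\mathbb{K}[T]$-algebra morphism $\mathbb{K}[T][X]\to\mathrm{Rees}(I)=\mathbb{K}[T][IZ]$, $X_i\mapsto u_i(T)Z$ ($Z$ a new variable). It is bihomogeneous with respect to total degrees in $T$ and in $X$; a bihomogeneous $P$ of bidegree $(i,j)$ belongs to $\mathcal{K}_{i,j}$ iff $P(T,u(T))=0$. The piece $\mathcal{K}_{*,1}$ of $X$-degree $1$ is identified with the syzygy module $\mathrm{Syz}(I)$ via $aX_1+bX_2+cX_3\leftrightarrow(a,b,c)$; it is a free $\mathbb{K}[T]$-module of rank $2$. A plane curve $C$ is parameterizable by $(F_1,F_2)$ (homogeneous forms of the same degree without common factors) if $C\dashrightarrow\mathbb{P}^1$, $x\mapsto(F_1(x):F_2(x))$, is birational with inverse a map $\mathbb{P}^1\to C$ given by three homogeneous polynomials of the same degree without common factors; it is parameterizable by conics (resp. lines) if this holds for some such pair of degree $2$ (resp. $1$). A parameterization is proper if it is birational onto $C$. That $(F_1,F_2)$ defines the inverse of $\phi$ means $(F_1(u(T)):F_2(u(T)))=(T_1:T_2)$, i.e. $T_1F_2(X)-T_2F_1(X)\in\mathcal{K}$. *)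

(* Defs.v *)
From HB Require Import structures.
From mathcomp Require Import all_boot all_algebra.
From mathcomp.multinomials Require Import mpoly.

Set Implicit Arguments.
Unset Strict Implicit.
Unset Printing Implicit Defensive.

Import GRing.Theory.
Local Open Scope ring_scope.

(* K[T][X], with T = (T_1, T_2) and X = (X_1, X_2, X_3). Everywhere, indices   *)
(* start at 0: T_1 = 'X_0 in {mpoly K[2]}, F_1 = F 0, F_2 = F 1, and so on.   *)
Notation "{ 'mpolyTX' K }" := {mpoly {mpoly K[2]}[3]} (format "{ 'mpolyTX'  K }").

Section Forms.
Variable K : closedFieldType.

Definition no_common_factor n m (f : 'I_m -> {mpoly K[n]}) : Prop :=
  forall g : {mpoly K[n]},
    (forall i, exists h, f i = g * h) -> g \is a GRing.unit.

Definition coprime_forms n m (e : nat) (f : 'I_m -> {mpoly K[n]}) : Prop :=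
  (forall i, f i \is e.-homog) /\ no_common_factor f.

Definition irreducible_mpoly n (E : {mpoly K[n]}) : Prop :=
  [/\ E != 0, E \isn't a GRing.unit &
      forall A B : {mpoly K[n]},
        E = A * B -> A \is a GRing.unit \/ B \is a GRing.unit].

Definition subst n m (f : 'I_m -> {mpoly K[n]}) (G : {mpoly K[m]}) :
  {mpoly K[n]} := G \mPo [tuple f i | i < m].

End Forms.

(* An irreducible projective variety is represented by the set of points of   *)
(* its affine cone (including the origin), and a rational map by a tuple of   *)
(* forms of the same degree that do not all vanish identically on the source. *)
(* At a base point the tuple evaluates to the origin, so that requiring the   *)
(* cone of X to be sent into the cone of Y only constrains the other points.  *)
(* The definitions below are meant for irreducible X and Y.                   *)
Section RationalMaps.
Variable K : closedFieldType.

Definition cone n := ('I_n -> K) -> Prop.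

Definition coneP1 : cone 2 := fun _ => True.

Definition cone_curve (E : {mpoly K[3]}) : cone 3 := fun x => E.@[x] = 0.

Definition vanishes_on n (X : cone n) (G : {mpoly K[n]}) : Prop :=
  forall x, X x -> G.@[x] = 0.

Definition rational_map n m (X : cone n) (Y : cone m)
    (f : 'I_m -> {mpoly K[n]}) : Prop :=
  [/\ exists e : nat, forall i, f i \is e.-homog,
      ~ (forall i, vanishes_on X (f i)) &
      forall x, X x -> Y (fun i => (f i).@[x])].

(* (f_1 : ... : f_n) = (X_1 : ... : X_n) as rational maps on X.               *)
Definition is_identity_on n (X : cone n) (f : 'I_n -> {mpoly K[n]}) : Prop :=
  ~ (forall i, vanishes_on X (f i)) /\
  (forall i j, vanishes_on X (f i * 'X_j - f j * 'X_i)).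

Definition comp_map n m l (g : 'I_l -> {mpoly K[m]})
    (f : 'I_m -> {mpoly K[n]}) : 'I_l -> {mpoly K[n]} :=
  fun i => subst f (g i).

Definition birational_inverse n m (X : cone n) (Y : cone m)
    (f : 'I_m -> {mpoly K[n]}) (g : 'I_n -> {mpoly K[m]}) : Prop :=
  [/\ rational_map X Y f, rational_map Y X g,
      is_identity_on X (comp_map g f) & is_identity_on Y (comp_map f g)].

Definition proper_parameterization (E : {mpoly K[3]})
    (u : 'I_3 -> {mpoly K[2]}) : Prop :=
  exists g : 'I_2 -> {mpoly K[3]},
    birational_inverse coneP1 (cone_curve E) u g.

Definition parameterizable_by (E : {mpoly K[3]})
    (F : 'I_2 -> {mpoly K[3]}) : Prop :=
  exists (v : 'I_3 -> {mpoly K[2]}) (e : nat),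
    coprime_forms e v /\ birational_inverse (cone_curve E) coneP1 F v.

(* e = 1: parameterizable by lines; e = 2: parameterizable by conics.         *)
Definition parameterizable_in_degree (e : nat) (E : {mpoly K[3]}) : Prop :=
  exists F : 'I_2 -> {mpoly K[3]}, coprime_forms e F /\ parameterizable_by E F.

(* (F_1(u(T)) : F_2(u(T))) = (T_1 : T_2).                                     *)
Definition defines_inverse (u : 'I_3 -> {mpoly K[2]})
    (F : 'I_2 -> {mpoly K[3]}) : Prop :=
  is_identity_on coneP1 (comp_map F u).

End RationalMaps.

Section Rees.
Variable K : closedFieldType.

Definition rees_map (u : 'I_3 -> {mpoly K[2]}) :
    {mpolyTX K} -> {poly {mpoly K[2]}} :=
  mmap (@polyC {mpoly K[2]}) (fun i => u i *: 'X).

Definition rees_ideal (u : 'I_3 -> {mpoly K[2]}) : {pred {mpolyTX K}} :=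
  [pred P | rees_map u P == 0].

(* P has T-degree i and X-degree j (or P = 0).                                *)
Definition bihomog (i j : nat) (P : {mpolyTX K}) : Prop :=
  P \is j.-homog /\ (forall m, P@_m \is i.-homog).

Definition bihomogeneous (P : {mpolyTX K}) : Prop :=
  exists i j : nat, bihomog i j P.

Definition Tvar (i : 'I_2) : {mpolyTX K} := ('X_i : {mpoly K[2]})%:MP.

Definition ofX (G : {mpoly K[3]}) : {mpolyTX K} := map_mpoly (@mpolyC 2 K) G.

(* Q(F_1(X), F_2(X), X).                                                      *)
Definition evalT (F : 'I_2 -> {mpoly K[3]}) (Q : {mpolyTX K}) : {mpoly K[3]} :=
  mmap (subst F) (fun i => 'X_i) Q.

Definition syzygy (u : 'I_3 -> {mpoly K[2]}) (a : 'rV[{mpoly K[2]}]_3) : Prop :=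
  \sum_i a 0 i * u i = 0.

(* (a, b, c) |-> a X_1 + b X_2 + c X_3.                                       *)
Definition syz_form (a : 'rV[{mpoly K[2]}]_3) : {mpolyTX K} :=
  \sum_i a 0 i *: 'X_i.

Definition syz_basis (u : 'I_3 -> {mpoly K[2]})
    (p q : 'rV[{mpoly K[2]}]_3) : Prop :=
  (forall a, syzygy u a <-> exists s t : {mpoly K[2]}, a = s *: p + t *: q) /\
  (forall s t : {mpoly K[2]}, s *: p + t *: q = 0 -> s = 0 /\ t = 0).

Definition homog_syz (k : nat) (a : 'rV[{mpoly K[2]}]_3) : Prop :=
  forall i, a 0 i \is k.-homog.

End Rees.

Definition generates (R : comNzRingType) (s : seq R) (I : {pred R}) : Prop :=
  forall x, x \in I <->
    exists c : 'I_(size s) -> R, x = \sum_(i < size s) c i * s`_i.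

(* No proper subsequence generates; in particular the entries are distinct.   *)
Definition minimal_generators (R : comNzRingType) (s : seq R) (I : {pred R}) :
  Prop :=
  generates s I /\ (forall s', subseq s' s -> generates s' I -> s' = s).

(* Main.v *)
(* Put D = T_1 F_2 - T_2 F_1, and for P in K[T][X] let phi(P) = P(F_1, F_2, X).
   Since (F_1(u) : F_2(u)) = (T_1 : T_2), phi maps the elements of the Rees ideal
   that are homogeneous in T to polynomials vanishing on C, that is, to multiples
   of E; and since F_1, F_2 are coprime, phi(P) = 0 forces D | P.
   - A syzygy P of T-degree i < k has phi(P) of degree 2i + 1 < d, so phi(P) = 0
     and P is a multiple of D, hence 0 (compare X-degrees).
   - Therefore p(1,0) and q(1,0) are linearly independent for any two independent
     syzygies p, q of degree k (they exist by counting dimensions): otherwise a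
     combination of them would be divisible by T_2.  So p(1,0,X) and q(1,0,X)
     generate the ideal of the point u(1,0), and every element of the Rees ideal of
     T-degree i >= k becomes a multiple of T_2 after subtracting a combination of
     p and q.  This descends to T-degree < k.
   - In T-degree i < k one subtracts a multiple of P_i, for which phi(P_i) = c E,
     and is left with a multiple of D.
   - Q exists because 6k unknowns satisfy 5k equations, whereas the multiples of D
     in bidegree (k-1, 2) form a space of dimension k - 1.
   - Minimality: by bidegree, the only possible relations are D = b P_{k-1},
     P_i = b D, p = b q and q = b p, and phi excludes the first two. *)
Require Import Defs.
From HB Require Import structures.
From mathcomp Require Import all_boot all_algebra perm ring zify.
From mathcomp.multinomials Require Import mpoly.
From Stdlib Require Import Classical.

Set Implicit Arguments.
Unset Strict Implicit.
Unset Printing Implicit Defensive.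

Import GRing.Theory.
Local Open Scope ring_scope.

(** * Gauss' lemma *)

Section Divisibility.
Variable A : idomainType.
Implicit Types a b c x y : A.

Definition dvds a b : Prop := exists c, b = a * c.

Definition irred a : Prop :=
  [/\ a != 0, a \isn't a GRing.unit &
      forall x y, a = x * y -> x \is a GRing.unit \/ y \is a GRing.unit].

(** Together with [atomic], this expresses unique factorization: irreducible elements are prime. *)
Definition irred_prime : Prop :=
  forall a, irred a -> forall x y, dvds a (x * y) -> dvds a x \/ dvds a y.

(** Existence of factorizations, encoded as an induction principle on nonzero elements so that
    proofs can strip irreducible factors one by one. *)
Definition atomic : Prop :=
  forall P : A -> Prop, (forall a, a \is a GRing.unit -> P a) ->
    (forall a b, irred a -> b != 0 -> P b -> P (a * b)) ->
    forall a, a != 0 -> P a.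

Lemma dvds_refl a : dvds a a.
Proof. by exists 1; rewrite mulr1. Qed.

Lemma dvds_mull a b c : dvds a b -> dvds a (c * b).
Proof. by case=> d ->; exists (c * d); rewrite mulrCA. Qed.

Lemma dvds_mulr a b c : dvds a b -> dvds a (b * c).
Proof. by rewrite mulrC; exact: dvds_mull. Qed.

Lemma dvdsD a b c : dvds a b -> dvds a c -> dvds a (b + c).
Proof. by move=> [x ->] [y ->]; exists (x + y); rewrite mulrDr. Qed.

Lemma dvdsN a b : dvds a b -> dvds a (- b).
Proof. by move=> [x ->]; exists (- x); rewrite mulrN. Qed.

Lemma dvdsB a b c : dvds a b -> dvds a c -> dvds a (b - c).
Proof. by move=> ab ac; apply/dvdsD/dvdsN. Qed.

(** Induction on the factorization of [a]: an irreducible factor of [a] is prime and by coprimality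
    cannot divide [b ^+ n], so it divides [c] and can be cancelled. *)
Lemma euclid (at_A : atomic) (ip_A : irred_prime) a b c n :
    (forall g, dvds g a -> dvds g b -> g \is a GRing.unit) ->
  a != 0 -> dvds a (c * b ^+ n) -> dvds a c.
Proof.
move=> cop a0; elim/at_A: {a}_ / a0 cop c => [a ua _ c _|a b' ia b0 IH cop c].
  by exists (a^-1 * c); rewrite mulVKr.
move=> [w hw].
have nab m : dvds a (b ^+ m) -> False.
  elim: m => [|m IHm].
    by case=> v; case: ia => _ /negP na _ hv; apply: na; apply/unitrP; exists v;
       rewrite mulrC -hv expr0.
  rewrite exprS => /(ip_A _ ia)[] // hab.
  case: ia => _ /negP + _; apply; apply: cop => //.
  exact/dvds_mulr/dvds_refl.
have [|[c' ec]|] := ip_A _ ia c (b ^+ n); last by move/nab.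
  by exists (b' * w); rewrite hw mulrA.
case: (IH _ c').
- by move=> g gb' gb; apply: cop => //; apply: dvds_mull.
- exists w; have a0 : a != 0 by case: ia.
  by apply: (mulfI a0); rewrite mulrA -ec hw mulrA.
- by move=> v ev; exists v; rewrite ec ev mulrA.
Qed.

End Divisibility.

Section Gauss.
Variable A : idomainType.
Hypotheses (at_A : atomic A) (ip_A : irred_prime A).
Implicit Types f g h : {poly A}.

Lemma dvds_polyC_X (a : A) f : a != 0 -> dvds a%:P (f * 'X) -> dvds a%:P f.
Proof.
move=> a0 [h]; elim/poly_ind: h => [|h c _] e.
  by exists 0; apply: (mulIf (negbT (polyX_eq0 A))); rewrite e !mulr0 mul0r.
have c0 : c = 0.
  move/(congr1 (fun p : {poly A} => p`_0)): e.
  rewrite coefMX /= coefCM coefD coefMX coefC /= add0r => /esym/eqP.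
  by rewrite mulf_eq0 (negPf a0) => /eqP.
exists h; apply: (mulIf (negbT (polyX_eq0 A))).
by rewrite e c0 addr0 mulrA.
Qed.

(** Double induction on the two factors. The product of the constant coefficients is divisible by
    [a], hence one of them is; dropping that coefficient and cancelling ['X] leaves a product with a
    shorter factor. *)
Lemma prime_polyC (a : A) : irred a ->
  forall f g, dvds a%:P (f * g) -> dvds a%:P f \/ dvds a%:P g.
Proof.
move=> ia; have a0 : a != 0 by case: ia.
have dC c : dvds a c -> dvds a%:P c%:P.
  by case=> d ->; exists d%:P; rewrite polyCM.
have z0 : dvds a%:P 0 by exists 0; rewrite mulr0.
have dX h c : dvds a%:P h -> dvds a c -> dvds a%:P (h * 'X + c%:P).
  by move=> ? /dC ?; apply: dvdsD => //; apply: dvds_mulr.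
elim/poly_ind => [|f c IHf] g; first by left.
elim/poly_ind: g => [|g e IHg]; first by right.
move=> hfg.
have : dvds a (c * e).
  case: hfg => h /(congr1 (fun p : {poly A} => p`_0)).
  rewrite coefM big_ord1 !coefD !coefMX !coefC /= !add0r coefCM => ->.
  by exists h`_0.
case/(ip_A ia) => ad.
- have: dvds a%:P (f * (g * 'X + e%:P)).
    apply: dvds_polyC_X => //.
    have -> : f * (g * 'X + e%:P) * 'X =
       (f * 'X + c%:P) * (g * 'X + e%:P) - c%:P * (g * 'X + e%:P).
      by rewrite mulrDl addrK mulrAC.
    by apply: dvdsB => //; apply/dvds_mulr/dC.
  by case/IHf; [left; apply: dX | right].
- have: dvds a%:P ((f * 'X + c%:P) * g).
    apply: dvds_polyC_X => //.
    have -> : (f * 'X + c%:P) * g * 'X =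
       (f * 'X + c%:P) * (g * 'X + e%:P) - (f * 'X + c%:P) * e%:P.
      by rewrite mulrDr addrK mulrA.
    by apply: dvdsB => //; apply/dvds_mull/dC.
  by case/IHg; [left | right; apply: dX].
Qed.

(** Each irreducible factor of [c] is prime in [{poly A}], so it divides one of the two factors and
    can be taken out of it. *)
Lemma split_content (c : A) f g h : c != 0 -> c%:P * f = g * h ->
  exists (c1 c2 : A) g1 h1, [/\ g = c1%:P * g1, h = c2%:P * h1 & f = g1 * h1].
Proof.
move=> c0; elim/at_A: {c}_ / c0 g h => [c uc g h e|c c' ic c'0 IH g h e].
  exists c, 1, (c^-1%:P * g), h; split.
  - by rewrite mulrA -polyCM divrr // mul1r.
  - by rewrite mul1r.
  - by rewrite -mulrA -e mulrA -polyCM mulVr // mul1r.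
have cP0 : c%:P != 0 :> {poly A} by rewrite polyC_eq0; case: ic.
have : dvds c%:P (g * h) by exists (c'%:P * f); rewrite -e polyCM mulrA.
case/(prime_polyC ic) => -[k ek]; rewrite ek polyCM -mulrA in e.
- have/IH [c1 [c2 [g1 [h1 [ek' -> ->]]]]] : c'%:P * f = k * h.
    by apply: (mulfI cP0); rewrite e mulrA.
  exists (c * c1), c2, g1, h1; split => //.
  by rewrite ek ek' polyCM mulrA.
- have/IH [c1 [c2 [g1 [h1 [-> ek' ->]]]]] : c'%:P * f = g * k.
    by apply: (mulfI cP0); rewrite e mulrCA.
  exists c1, (c * c2), g1, h1; split => //.
  by rewrite ek ek' polyCM mulrA.
Qed.

(** An irreducible factor of [c] divides [f * w]. It does not divide [f], which is irreducible of
    positive degree, so it divides [w] and cancels on both sides. *)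
Lemma irred_dvds_scale (c : A) f g : c != 0 -> irred f -> (1 < size f)%N ->
  dvds f (c%:P * g) -> dvds f g.
Proof.
move=> c0 irf sf; elim/at_A: {c}_ / c0 g => [c uc g [w e]|c c' ic c'0 IH g].
  exists (c^-1%:P * w).
  by rewrite mulrCA -e mulrA -polyCM mulVr // mul1r.
have cP0 : c%:P != 0 :> {poly A} by rewrite polyC_eq0; case: ic.
rewrite polyCM -mulrA => -[w e].
have : dvds c%:P (f * w) by exists (c'%:P * g).
case/(prime_polyC ic) => -[k ek].
  case: (irf) => _ _ /(_ _ _ ek)[].
    by rewrite poly_unitE coefC /= => /andP[_ uc]; case: ic => _ /negP[].
  rewrite poly_unitE => /andP[/eqP sk _].
  move: sf; rewrite ek size_Cmul ?sk //.
  by rewrite polyC_eq0 in cP0.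
apply: IH; exists k.
by apply: (mulfI cP0); rewrite e ek mulrCA.
Qed.

(** The gcd over the fraction field has a denominator-free Bezout expression [r]. If [r] had
    positive degree, removing constant factors would show [f] to be a unit times a factor of [r], so
    [f] would divide a constant multiple of [g], hence [g]. *)
Lemma bezout_irred f g : irred f -> (1 < size f)%N -> ~ dvds f g ->
  exists (r : A) h k, r != 0 /\ r%:P = h * f + k * g.
Proof.
move=> irf sf nfg; have f0 : f != 0 by case: irf.
have [[h k] /= hk] := Bezoutp f g.
set r := h * f + k * g in hk.
have rf : r %| f by rewrite (eqp_dvdl _ hk) dvdp_gcdl.
have rg : r %| g by rewrite (eqp_dvdl _ hk) dvdp_gcdr.
have r0 : r != 0 by apply: contraNneq f0 => r0; rewrite r0 dvd0p in rf.
have [sr|sr] := leqP (size r) 1.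
  have er := size1_polyC sr.
  exists r`_0, h, k; split; last by rewrite -er.
  by apply: contraNneq r0 => z; rewrite er z.
case: nfg.
(* The relation [%|] gives divisibility only up to a nonzero constant of [A]; [split_content]
   absorbs that constant. *)
have [[c q] /= c0 ec] := Pdiv.Idomain.dvdpP _ _ rf.
rewrite -mul_polyC in ec.
have [c1 [c2 [q1 [r1 [eq er ef]]]]] := split_content c0 ec.
case: (irf) => _ _ /(_ _ _ ef)[u|u]; last first.
  move: sr; rewrite er; move: u; rewrite poly_unitE => /andP[/eqP s1 _].
  have := size_polyMleq c2%:P r1; rewrite s1 addn1 /= => le1 le2.
  by have := leq_trans le2 le1; rewrite ltnNge size_polyC_leq1.
have [[c' q'] /= c'0 ec'] := Pdiv.Idomain.dvdpP _ _ rg.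
apply: (@irred_dvds_scale c') => //.
rewrite mul_polyC ec' er; apply/dvds_mull/dvds_mull.
by exists (q1^-1); rewrite ef mulrC mulKr.
Qed.

(** Constants are handled by [prime_polyC]. Otherwise, if [f] does not divide [x], some nonzero
    constant equals [h * f + k * x]; multiplied by [y], it becomes a multiple of [f]. *)
Lemma gauss : irred_prime {poly A}.
Proof.
move=> f irf x y fxy; have f0 : f != 0 by case: irf.
have [sf|sf] := leqP (size f) 1.
  have ef := size1_polyC sf; rewrite ef in irf fxy *.
  apply: prime_polyC => //; case: irf => c0 nu ir; split.
  - by rewrite -polyC_eq0.
  - by apply: contra nu; rewrite poly_unitE coefC size_polyC -polyC_eq0 c0.
  - move=> a b e; have [] := ir a%:P b%:P; first by rewrite e polyCM.
      by rewrite poly_unitE coefC => /andP[]; left.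
    by rewrite poly_unitE coefC => /andP[]; right.
have [fx|nfx] := classic (dvds f x); [by left | right].
have [r [h [k [r0 er]]]] := bezout_irred irf sf nfx.
apply: (irred_dvds_scale r0) => //; rewrite er mulrDl.
apply: dvdsD; first by apply/dvds_mulr/dvds_mull/dvds_refl.
by rewrite -mulrA; apply: dvds_mull.
Qed.

End Gauss.

Lemma irred_iso (A B : idomainType) (f : {rmorphism A -> B})
    (g : {rmorphism B -> A}) :
  cancel f g -> cancel g f -> forall a, irred a -> irred (f a).
Proof.
move=> fK gK a [a0 nua ia]; split.
- by apply: contraNneq a0 => fa0; rewrite -(fK a) fa0 rmorph0.
- by apply: contra nua => /(rmorph_unit g); rewrite fK.
- move=> x y e; have [] := ia (g x) (g y); first by rewrite -rmorphM -e fK.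
    by move/(rmorph_unit f); rewrite gK; left.
  by move/(rmorph_unit f); rewrite gK; right.
Qed.

Lemma dvds_morph (A B : idomainType) (f : {rmorphism A -> B}) a b :
  dvds a b -> dvds (f a) (f b).
Proof. by case=> c ->; exists (f c); rewrite rmorphM. Qed.

Lemma irred_prime_iso (A B : idomainType) (f : {rmorphism A -> B})
    (g : {rmorphism B -> A}) :
  cancel f g -> cancel g f -> irred_prime B -> irred_prime A.
Proof.
move=> fK gK ip a ia x y /(dvds_morph f); rewrite rmorphM.
case/(ip _ (irred_iso fK gK ia)) => /(dvds_morph g); rewrite !fK.
  by left.
by right.
Qed.

Lemma mpoly_morph_ext n (R : comNzRingType) (S : comNzRingType)
    (f g : {rmorphism {mpoly R[n]} -> S}) :
  (forall c, f c%:MP = g c%:MP) -> (forall i, f 'X_i = g 'X_i) -> f =1 g.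
Proof.
move=> fgC fgX p; rewrite [p]mpolyE !rmorph_sum; apply: eq_bigr => m _.
rewrite -mul_mpolyC !rmorphM fgC mpolyXE_id !rmorph_prod; congr (_ * _).
by apply: eq_bigr => i _; rewrite !rmorphXn fgX.
Qed.

(** * Unique factorization and elimination in polynomial rings over a field *)

Section MpolyFactorization.
Variable K : fieldType.

Lemma mpoly_unitP n (a : {mpoly K[n]}) :
  reflect (exists2 c, c != 0 & a = c%:MP) (a \is a GRing.unit).
Proof.
apply: (iffP idP) => [/andP[/eqP ea uc]|[c c0 ->]]; last first.
  by apply/andP; rewrite mcoeffC eqxx mulr1 unitfE; split.
by exists a@_0; rewrite // -unitfE.
Qed.

Lemma mpoly_unit_msize n (a : {mpoly K[n]}) :
  (a \is a GRing.unit) = (msize a == 1).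
Proof. by apply/mpoly_unitP/msize_poly1P. Qed.

(** Induction on [msize]: units are the elements of [msize] 1, so in a product of two non-units both
    factors are smaller. *)
Lemma mpoly_irred_factor n (a : {mpoly K[n]}) :
  a != 0 -> a \isn't a GRing.unit -> exists p b, irred p /\ a = p * b.
Proof.
have [s] := ubnP (msize a); elim: s a => // s IH a; rewrite ltnS => les a0 nua.
have [ia|nia] := classic (irred a).
  by exists a, 1; rewrite mulr1.
have [x [y [e nux nuy]]] : exists x y,
    [/\ a = x * y, x \isn't a GRing.unit & y \isn't a GRing.unit].
  apply: NNPP => nex; apply: nia; split => // x y e.
  have [ux|nux] := boolP (x \is a GRing.unit); first by left.
  have [uy|nuy] := boolP (y \is a GRing.unit); first by right.
  by case: nex; exists x, y.
have [x0 y0] : x != 0 /\ y != 0.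
  by apply/andP; move: a0; rewrite e mulf_eq0 negb_or.
have sxy := msizeM x0 y0; rewrite -e in sxy.
have [|p [b [ip eb]]] := IH x _ x0 nux.
  apply: leq_trans les; rewrite sxy.
  rewrite !mpoly_unit_msize in nux nuy.
  have := mpolySpred mdeg y0; move: nuy.
  by case: (msize y) => [|[|m]] // _ _; rewrite addnS /= addnS ltnS leq_addr.
by exists p, (b * y); rewrite mulrA -eb.
Qed.

Lemma mpoly_atomic n : atomic {mpoly K[n]}.
Proof.
move=> P Pu PM a; have [s] := ubnP (msize a).
elim: s a => // s IH a; rewrite ltnS => les a0.
have [/Pu//|nua] := boolP (a \is a GRing.unit).
have [p [b [ip e]]] := mpoly_irred_factor a0 nua.
have [p0 nup _] := ip.
have b0 : b != 0 by move: a0; rewrite e mulf_eq0 negb_or => /andP[].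
rewrite e; apply: PM => //; apply: IH => //.
apply: leq_trans les; rewrite e msizeM //.
rewrite mpoly_unit_msize in nup.
have := mpolySpred mdeg p0; have := mpolySpred mdeg b0; move: nup.
by case: (msize p) (msize b) => [|[|m]] [|l] // _ _ _; rewrite addSn /= addSn ltnS leq_addl.
Qed.

(** Inverse of [muni], which reads a polynomial in n + 1 variables as a univariate one in the last
    variable; the isomorphism transports Gauss' lemma. *)
Definition mpoly_of_poly n (q : {poly {mpoly K[n]}}) : {mpoly K[n.+1]} :=
  (map_poly (@mwiden n K) q).['X_ord_max].

HB.instance Definition _ n := GRing.RMorphism.copy (@mpoly_of_poly n)
  (horner_eval 'X_ord_max \o map_poly (@mwiden n K)).

Lemma muni_Xmax n : muni 'X_ord_max = 'X :> {poly {mpoly K[n]}}.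
Proof.
rewrite muniE msuppX big_seq1 mcoeffX eqxx scale1r.
rewrite mnm1E eqxx expr1 (_ : [multinom _ | _ < _] = 0%MM) ?mpolyX0 ?scale1r //.
apply/mnmP => i; rewrite mnmE mnm0E mnm1E; apply/eqP; rewrite eqb0 -val_eqE /=.
by rewrite neq_ltn ltn_ord orbT.
Qed.

Lemma muni_Xwiden n (i : 'I_n) : 
  muni 'X_(widen_ord (leqnSn n) i) = ('X_i)%:P :> {poly {mpoly K[n]}}.
Proof.
rewrite muniE msuppX big_seq1 mcoeffX eqxx scale1r.
rewrite mnm1E -val_eqE /= ltn_eqF ?ltn_ord // expr0 -mul_polyC mulr1.
congr ('X_[_])%:P; apply/mnmP => j; rewrite mnmE !mnm1E.
by rewrite -!val_eqE.
Qed.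

Lemma muni_mwiden n (p : {mpoly K[n]}) : muni (mwiden p) = p%:P.
Proof.
apply: (mpoly_morph_ext (f := @muni n K \o @mwiden n K) (g := polyC)) p => [c|i] /=.
  by rewrite mwidenC muniC.
rewrite /mwiden mmapX mmap1U.
rewrite -muni_Xwiden; congr (muni 'X_(_)); exact/val_inj.
Qed.

Lemma muniK n : cancel (@muni n K) (@mpoly_of_poly n).
Proof.
move=> p; apply: (mpoly_morph_ext (f := @mpoly_of_poly n \o @muni n K) (g := idfun)) p.
  by move=> c /=; rewrite muniC /mpoly_of_poly map_polyC hornerC /= mwidenC.
move=> i /=; have [->|[j ->]] : i = ord_max \/ exists j, i = widen_ord (leqnSn n) j.
- have [lt_in|ge_in] := ltnP i n.
    by right; exists (Ordinal lt_in); apply: val_inj.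
  by left; apply: val_inj; apply/eqP; rewrite eqn_leq ge_in -ltnS ltn_ord.
- by rewrite muni_Xmax /mpoly_of_poly map_polyX hornerX.
- rewrite muni_Xwiden /mpoly_of_poly map_polyC hornerC /= /mwiden mmapX mmap1U.
  by congr ('X_(_)); apply: val_inj.
Qed.

Lemma mpoly_of_polyK n : cancel (@mpoly_of_poly n) (@muni n K).
Proof.
elim/poly_ind => [|q c IH]; first by rewrite !rmorph0.
rewrite !rmorphD !rmorphM /= IH /mpoly_of_poly map_polyX hornerX muni_Xmax.
by rewrite map_polyC hornerC /= muni_mwiden.
Qed.

Lemma field_irred_prime : irred_prime K.
Proof. by move=> a [a0]; rewrite unitfE a0. Qed.

(** Induction on the number of variables, applying Gauss' lemma to the last one. *)
Lemma mpoly_irred_prime n : irred_prime {mpoly K[n]}.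
Proof.
elim: n => [|n IH].
  apply: (irred_prime_iso (f := mcoeff 0%MM) (g := @mpolyC 0 K)) field_irred_prime.
    by move=> p; rewrite [RHS]nvar0_mpolyC.
  exact: mpolyCK.
exact: (irred_prime_iso (@muniK n) (@mpoly_of_polyK n) (gauss (@mpoly_atomic n) IH)).
Qed.

(* The case distinction covers E without the last variable: then E itself is
   the eliminant. *)
Lemma mpoly_eliminate n (E G : {mpoly K[n.+1]}) : irred E -> ~ dvds E G ->
  exists (r : {mpoly K[n]}) H L, r != 0 /\ mwiden r = H * E + L * G.
Proof.
move=> irE nEG.
have irmE := irred_iso (@muniK n) (@mpoly_of_polyK n) irE.
have mwidenE' r : mwiden r = mpoly_of_poly r%:P :> {mpoly K[n.+1]}.
  by rewrite /mpoly_of_poly map_polyC hornerC.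
have [sE|sE] := leqP (size (muni E)) 1.
  have e := size1_polyC sE; exists ((muni E)`_0), 1, 0; split.
    by rewrite -polyC_eq0 -e; case: irmE.
  by rewrite mwidenE' -e muniK mul1r mul0r addr0.
have [|r [h [k [r0 er]]]] :=
  bezout_irred (@mpoly_atomic n) (@mpoly_irred_prime n) irmE sE (g := muni G).
  case=> c ec; apply: nEG; exists (mpoly_of_poly c).
  by apply: (can_inj (@muniK n)); rewrite muniM (mpoly_of_polyK c).
exists r, (mpoly_of_poly h), (mpoly_of_poly k); split => //.
apply: (can_inj (@muniK n)).
by rewrite muniD !muniM (mpoly_of_polyK h) (mpoly_of_polyK k) muni_mwiden.
Qed.

End MpolyFactorization.

(** * The ideal of the curve *)

Section Evaluation.

Lemma mmap_homog n (R : comNzRingType) (S : comNzRingType) (h : R -> S)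
    (v : 'I_n -> S) (z : S) d (f : {mpoly R[n]}) :
  f \is d.-homog -> mmap h (fun i => z * v i) f = z ^+ d * mmap h v f.
Proof.
move=> /dhomogP hf; rewrite /mmap mulr_sumr !big_seq; apply: eq_bigr => m /hf <-.
rewrite mulrCA; congr (_ * _); rewrite /mmap1.
under eq_bigr do rewrite exprMn.
by rewrite big_split /= prodrXr mdegE.
Qed.

Lemma mmap_eq n (R S : comNzRingType) (h : R -> S) (v w : 'I_n -> S)
  (f : {mpoly R[n]}) : v =1 w -> mmap h v f = mmap h w f.
Proof. by move=> vw; apply: eq_bigr => m _; rewrite (mmap1_eq _ vw). Qed.

End Evaluation.

Lemma rmorph_comb0 (A B : pzSemiRingType) (f : {rmorphism A -> B}) x y a b :
  f a = 0 -> f b = 0 -> f (x * a + y * b) = 0.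
Proof. by move=> fa fb; rewrite rmorphD !rmorphM fa fb !mulr0 addr0. Qed.

(** * Vanishing polynomials and binary forms over an algebraically closed field *)

Section ClosedField.
Variable K : closedFieldType.

(** If [p] vanishes everywhere, then [p + 1] has no root and is therefore constant. *)
Lemma poly_vanish (p : {poly K}) : (forall x, p.[x] = 0) -> p = 0.
Proof.
move=> p0; have : ~~ (size (p + 1) != 1).
  apply/negP => /closed_rootP[x]; rewrite rootE hornerD p0 hornerC add0r.
  by rewrite oner_eq0.
rewrite negbK => /eqP/eq_leq/size1_polyC e.
have ep : p = ((p + 1)`_0 - 1)%:P by rewrite polyCB -e addrK.
by have := p0 0; rewrite ep hornerC => ->.
Qed.

(** Induction on the number of variables: with the first [n] coordinates fixed, [f] becomes a
    univariate polynomial in the last one that vanishes everywhere. *)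
Lemma mpoly_vanish n (f : {mpoly K[n]}) : (forall x, f.@[x] = 0) -> f = 0.
Proof.
elim: n f => [|n IH] f f0.
  have e := nvar0_mpolyC f; move: (f0 (fun=> 0)).
  by rewrite e mevalC => ->; rewrite mpolyC0.
apply: (can_inj (@muniK _ n)); rewrite rmorph0; apply/polyP => i; rewrite coef0.
apply: IH => x.
suff -> : ((muni f)`_i).@[x] = (map_poly (meval x) (muni f))`_i.
  suff -> : map_poly (meval x) (muni f) = 0 by rewrite coef0.
  apply: poly_vanish => t.
  (* The point [x] extended by [t] as its last coordinate. *)
  pose y (j : 'I_n.+1) := if insub (val j) is Some k then x k else t.
  rewrite -(f0 y); move: f {f0} =>f.
  apply: (mpoly_morph_ext (f := horner_eval t \o map_poly (meval x) \o @muni n K)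
    (g := meval y)) f => [c|j] /=.
    by rewrite muniC map_polyC /= mevalC /horner_eval hornerC mevalC.
  rewrite mevalXU /y; case: insubP => [k kn e|].
    have -> : j = widen_ord (leqnSn n) k by apply: val_inj; rewrite /= e.
    by rewrite muni_Xwiden map_polyC /horner_eval hornerC /= mevalXU.
  rewrite -leqNgt => ge_jn.
  have -> : j = ord_max.
    by apply: val_inj; apply/eqP; rewrite eqn_leq ge_jn -ltnS ltn_ord.
  by rewrite muni_Xmax map_polyX /horner_eval hornerX.
by rewrite coef_map.
Qed.

(** The sum is the binary form of degree [n] with dehomogenization [p], evaluated at [(a, b)]. Over
    an algebraically closed field it splits into linear forms, one of which must vanish. *)
Lemma binary_form_zero (S : idomainType) (phi : {rmorphism K -> S}) (a b : S) n
    (p : {poly K}) : p != 0 -> (size p <= n.+1)%N ->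
  \sum_(i < n.+1) phi p`_i * (a ^+ i * b ^+ (n - i)) = 0 ->
  b = 0 \/ exists w, a = phi w * b.
Proof.
elim: n p => [|n IH] p p0 sp.
  rewrite big_ord1 !expr0 !mulr1 => /eqP; rewrite fmorph_eq0 => /eqP z.
  by move: p0; rewrite (size1_polyC sp) z eqxx.
(* A drop in degree means that [b] is a factor of the form; otherwise a root [w] of [p] gives the
   factor [a - phi w * b]. *)
have [sp'|sp'] := leqP (size p) n.+1.
  rewrite big_ord_recr /= nth_default // rmorph0 mul0r addr0 => e.
  suff /eqP : b * \sum_(i < n.+1) phi p`_i * (a ^+ i * b ^+ (n - i)) = 0.
    by rewrite mulf_eq0 => /orP[/eqP|/eqP/IH]; [left | apply].
  rewrite mulr_sumr -[RHS]e; apply: eq_bigr => i _.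
  by rewrite subSn -1?ltnS // exprS; ring.
have /closed_rootP[w /factor_theorem[q eq]] : size p != 1.
  by apply: contraTneq sp' => ->.
have q0 : q != 0 by apply: contraNneq p0 => q0; rewrite eq q0 mul0r.
have sq : (size q <= n.+1)%N.
  by move: sp; rewrite eq size_Mmonic ?monicXsubC // size_XsubC addn2.
have ep i : phi p`_i = phi (q * 'X)`_i - phi w * phi q`_i.
  by rewrite eq mulrBr coefB coefMC rmorphB rmorphM; ring.
pose M i := a ^+ i * b ^+ (n.+1 - i).
move=> e; have {e} : \sum_(i < n.+2) phi (q * 'X)`_i * M i -
    phi w * \sum_(i < n.+2) phi q`_i * M i = 0.
  rewrite -[RHS]e mulr_sumr -sumrB; apply: eq_bigr => i _.
  by rewrite ep /M; ring.
rewrite big_ord_recl coefMX /= rmorph0 mul0r add0r.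
rewrite [X in _ - _ * X]big_ord_recr /= [q`_n.+1]nth_default // rmorph0 mul0r addr0.
have -> : \sum_(i < n.+1) phi (q * 'X)`_(bump 0 i) * M (bump 0 i) =
    a * \sum_(i < n.+1) phi q`_i * (a ^+ i * b ^+ (n - i)).
  rewrite mulr_sumr; apply: eq_bigr => i _.
  by rewrite /bump /= add1n coefMX /M subSS exprS /=; ring.
have -> : \sum_(i < n.+1) phi q`_i * M i =
    b * \sum_(i < n.+1) phi q`_i * (a ^+ i * b ^+ (n - i)).
  rewrite mulr_sumr; apply: eq_bigr => i _.
  by rewrite /M subSn -1?ltnS // exprS; ring.
rewrite mulrA -mulrBl.
move/eqP; rewrite mulf_eq0 => /orP[|/eqP/IH]; last by apply.
by rewrite subr_eq0 => /eqP ->; right; exists w.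
Qed.

Definition mnm2 i j : 'X_{1..2} := (U_(0%R) *+ i + U_(1%R) *+ j)%MM.

Lemma mnm2E (m : 'X_{1..2}) : m = mnm2 (m 0%R) (m 1%R).
Proof.
by rewrite [LHS]multinomUE_id big_ord_recl big_ord1 /mnm2;
   congr (U_(_) *+ m _ + U_(_) *+ m _)%MM; apply: val_inj.
Qed.

Lemma mdeg2E (m : 'X_{1..2}) : mdeg m = (m 0%R + m 1%R)%N.
Proof.
by rewrite mdegE big_ord_recl big_ord1; congr (m _ + m _)%N; apply: val_inj.
Qed.

Lemma mnm2_0 i j : mnm2 i j 0%R = i.
Proof. by rewrite mnmDE !mulmnE !mnm1E /= mul1n mul0n addn0. Qed.

Lemma mnm2_1 i j : mnm2 i j 1%R = j.
Proof. by rewrite mnmDE !mulmnE !mnm1E /= mul1n mul0n. Qed.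

Lemma mpolyX2 (R : comNzRingType) i j :
  'X_[mnm2 i j] = 'X_0 ^+ i * 'X_1 ^+ j :> {mpoly R[2]}.
Proof. by rewrite mpolyXD -!mpolyXn. Qed.

Lemma binary_formE (R : comNzRingType) n (f : {mpoly R[2]}) : f \is n.-homog ->
  f = \sum_(i < n.+1) f@_(mnm2 i (n - i)) *: ('X_0 ^+ i * 'X_1 ^+ (n - i)).
Proof.
move=> hf; apply/mpolyP => m; rewrite raddf_sum /=.
have [dm|dm] := eqVneq (mdeg m) n.
  have lt : (m 0%R < n.+1)%N by rewrite ltnS -dm mdeg2E leq_addr.
  have e : m = mnm2 (Ordinal lt) (n - Ordinal lt).
    by rewrite [LHS]mnm2E /= -dm mdeg2E addKn.
  rewrite (bigD1 (Ordinal lt)) //= big1 ?addr0 => [|i ni].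
    by rewrite mcoeffZ -mpolyX2 mcoeffX -e eqxx mulr1.
  rewrite mcoeffZ -mpolyX2 mcoeffX; case: eqP => [em|]; last by rewrite mulr0.
  by case/eqP: ni; apply: val_inj; rewrite /= -em mnm2_0.
rewrite (dhomog_nemf_coeff hf dm) big1 // => i _.
rewrite mcoeffZ -mpolyX2 mcoeffX; case: eqP => [em|]; last by rewrite mulr0.
by case/eqP: dm; rewrite -em mdeg2E mnm2_0 mnm2_1 subnKC // -ltnS.
Qed.

End ClosedField.

(** * Polynomials that vanish along a parameterization *)

Section Parametrization.
Variable K : closedFieldType.

(* The substitution X_i := u_i(T) Z, under which a polynomial vanishes iff all
   its homogeneous components vanish at u. *)
Definition evalZ n (u : 'I_n -> {mpoly K[2]}) : {mpoly K[n]} -> {poly {mpoly K[2]}} :=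
  mmap (polyC \o @mpolyC 2 K) (fun i => u i *: 'X).

HB.instance Definition _ n u := GRing.RMorphism.copy (@evalZ n u)
  (mmap (polyC \o @mpolyC 2 K) (fun i => u i *: 'X)).

Lemma evalZ_X n (u : 'I_n -> {mpoly K[2]}) i : evalZ u 'X_i = u i *: 'X.
Proof. by rewrite /evalZ mmapX mmap1U. Qed.

Lemma evalZ_C n (u : 'I_n -> {mpoly K[2]}) c : evalZ u c%:MP = c%:MP%:P.
Proof. by rewrite /evalZ mmapC. Qed.

Lemma substE n m (f : 'I_m -> {mpoly K[n]}) G : subst f G = mmap (@mpolyC n K) f G.
Proof. by apply: mmap_eq => i; rewrite tnth_mktuple. Qed.

HB.instance Definition _ n m f := GRing.RMorphism.copy (@subst K n m f)
  (comp_mpoly [tuple f i | i < m]).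

Lemma subst_X n m (f : 'I_m -> {mpoly K[n]}) i : subst f 'X_i = f i.
Proof. by rewrite substE mmapX mmap1U. Qed.

Lemma subst_C n m (f : 'I_m -> {mpoly K[n]}) c : subst f c%:MP = c%:MP.
Proof. by rewrite substE mmapC. Qed.

Lemma evalZ_homog n (u : 'I_n -> {mpoly K[2]}) d G : G \is d.-homog ->
  evalZ u G = subst u G *: 'X^d.
Proof.
move=> hG; rewrite /evalZ (mmap_eq _ _ (w := fun i => 'X * (u i)%:P)); last first.
  by move=> i; rewrite mulrC mul_polyC.
rewrite (mmap_homog _ _ _ hG) -mul_polyC mulrC; congr (_ * _).
apply: (mpoly_morph_ext (f := mmap (polyC \o @mpolyC 2 K) (fun i => (u i)%:P))
  (g := polyC \o subst u) _ _ G) => [c|i] /=.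
  by rewrite mmapC subst_C.
by rewrite mmapX mmap1U subst_X.
Qed.

Lemma evalZ_coef n (u : 'I_n -> {mpoly K[2]}) d G :
  (evalZ u G)`_d = subst u (pihomog mdeg d G).
Proof.
have [k hk] : exists k, (msize G <= k)%N /\ (d < k)%N.
  by exists (maxn (msize G) d.+1); rewrite leq_maxl leq_maxr.
rewrite {1}(pihomog_partitionE hk.1) rmorph_sum coef_sum /=.
rewrite (bigD1 (Ordinal hk.2)) //= big1 ?addr0 => [|i ni].
  by rewrite (evalZ_homog _ (pihomogP _ _ _)) coefZ coefXn eqxx mulr1.
rewrite (evalZ_homog _ (pihomogP _ _ _)) coefZ coefXn.
case: eqP => [e|]; last by rewrite mulr0.
by case/eqP: ni; apply: val_inj.
Qed.

(** The homogeneous component of [r] that contains its leading monomial is a nonzero binary form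
    vanishing at [u], so a linear form vanishes there. *)
Lemma evalZ_binary (u : 'I_2 -> {mpoly K[2]}) r : r != 0 -> evalZ u r = 0 ->
  u 1 = 0 \/ exists w, u 0 = w *: u 1.
Proof.
move=> r0 er; set n := mdeg (mlead r).
have : subst u (pihomog mdeg n r) = 0 by rewrite -evalZ_coef er coef0.
set f := pihomog mdeg n r; have hf : f \is n.-homog by apply: pihomogP.
have f0 : f@_(mlead r) != 0.
  rewrite /f pihomogE raddf_sum /= -big_filter.
  rewrite (bigD1_seq (mlead r)) ?filter_uniq ?msupp_uniq //=; last first.
    by rewrite mem_filter eqxx mlead_supp.
  rewrite big1 ?addr0; first by rewrite mcoeffZ mcoeffX eqxx mulr1 mleadc_eq0.
  by move=> m nm; rewrite mcoeffZ mcoeffX (negPf nm) mulr0.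
rewrite {1}(binary_formE hf) rmorph_sum /=.
pose p : {poly K} := \poly_(i < n.+1) f@_(mnm2 i (n - i)).
have p0 : p != 0.
  apply: contraNneq f0 => p0.
  have := congr1 (fun q : {poly K} => q`_(mlead r 0%R)) p0.
  rewrite coef_poly coef0 ltnS /n mdeg2E leq_addr addKn -mnm2E => ->.
  by [].
move=> e; have [||u1|[w ew]] :=
  binary_form_zero (phi := @mpolyC 2 K) (a := u 0) (b := u 1) (n := n) p0.
- exact: size_poly.
- rewrite -[RHS]e; apply: eq_bigr => i _.
  rewrite coef_poly ltn_ord -mul_mpolyC !rmorphM !rmorphXn /= subst_C.
  by rewrite !subst_X.
- by left.
- by right; exists w; rewrite -mul_mpolyC.
Qed.

(** Elimination removes the last variable, while two non-proportional coordinates of [u] may stand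
    anywhere; a permutation of the variables moves them to the front. *)
Definition permX (s : 'S_3) : {mpoly K[3]} -> {mpoly K[3]} :=
  subst (fun i => 'X_(s i)).

HB.instance Definition _ s := GRing.RMorphism.copy (permX s)
  (subst (fun i => 'X_(s i))).

Lemma permXK s : cancel (permX s) (permX s^-1%g).
Proof.
move=> G; apply: (mpoly_morph_ext (f := permX s^-1%g \o permX s) (g := idfun)) G.
  by move=> c /=; rewrite /permX !subst_C.
by move=> i /=; rewrite /permX !subst_X permK.
Qed.

Lemma evalZ_permX (u : 'I_3 -> {mpoly K[2]}) s G :
  evalZ u (permX s G) = evalZ (u \o s) G.
Proof.
apply: (mpoly_morph_ext (f := evalZ u \o permX s) (g := evalZ (u \o s))) G.
  by move=> c /=; rewrite /permX subst_C !evalZ_C.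
by move=> i /=; rewrite /permX subst_X !evalZ_X.
Qed.

Lemma evalZ_mwiden n (u : 'I_n.+1 -> {mpoly K[2]}) G :
  evalZ u (mwiden G) = evalZ (u \o widen_ord (leqnSn n)) G.
Proof.
apply: (mpoly_morph_ext (f := evalZ u \o @mwiden n K)
  (g := evalZ (u \o widen_ord (leqnSn n)))) G.
  by move=> c /=; rewrite mwidenC !evalZ_C.
move=> i /=; rewrite /mwiden mmapX mmap1U !evalZ_X /=; congr (u _ *: _).
Qed.

(** If every pair were dependent, all [u i] would be multiples of one of them, a common factor of
    positive degree. The permutation is an involution so that [permX s] is its own inverse. *)
Lemma coprime_forms_indep d (u : 'I_3 -> {mpoly K[2]}) : (0 < d)%N ->
  coprime_forms d u ->
  exists2 s : 'S_3, (s * s = 1)%g & ~ (u (s 1) = 0 \/ exists w, u (s 0) = w *: u (s 1)).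
Proof.
move=> d0 [hu cu]; apply: NNPP => nex.
have dep (s : 'S_3) : (s * s = 1)%g -> u (s 1) = 0 \/ exists w, u (s 0) = w *: u (s 1).
  by move=> ss; apply: NNPP => ns; apply: nex; exists s.
have mul g : g \is d.-homog -> (forall i, exists w, u i = w *: g) -> False.
  move=> hg ug; have : g \is a GRing.unit.
    apply: cu => i; have [w ->] := ug i; exists w%:MP.
    by rewrite mulrC mul_mpolyC.
  case/mpoly_unitP => c c0 eg.
  have g0 : g != 0 by rewrite eg mpolyC_eq0.
  have h0 : g \is 0.-homog by rewrite eg -alg_mpolyC dhomogZ // dhomog1.
  by move: d0; rewrite (dhomog_uniq g0 hg h0).
have s1 := dep 1%g (mulg1 _); rewrite !perm1 in s1.
have s2 := dep (tperm 1 2%R) (tperm2 _ _).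
have s3 := dep (tperm 0 2%R) (tperm2 _ _).
rewrite tpermL tpermD // in s2; rewrite tpermL tpermD // in s3.
have all3 (P : 'I_3 -> Prop) : P 0 -> P 1 -> P 2%R -> forall i, P i.
  move=> P0 P1 P2 i.
  have : i \in [:: 0; 1; 2%R : 'I_3] by case: i => [[|[|[|]]]].
  by rewrite !inE => /or3P[] /eqP ->.
have z (g : {mpoly K[2]}) : exists w : K, 0 = w *: g by exists 0; rewrite scale0r.
have o (g : {mpoly K[2]}) : exists w : K, g = w *: g by exists 1; rewrite scale1r.
have [u1|u1] := eqVneq (u 1) 0.
  case: s2 => [u2|u02].
    by apply: (mul (u 0)) => //; apply: all3; rewrite ?u1 ?u2.
  by apply: (mul (u 2%R)) => //; apply: all3; rewrite ?u1.
case: s1 => [/eqP|u01]; first by rewrite (negPf u1).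
case: s3 => [/eqP|u21]; first by rewrite (negPf u1).
by apply: (mul (u 1)) => //; apply: all3.
Qed.

(** If [E] did not divide [G], eliminating a variable would give a nonzero polynomial in two
    variables that vanishes at two non-proportional coordinates of [u]. *)
Lemma implicit_equation_dvds d (u : 'I_3 -> {mpoly K[2]}) E G : (0 < d)%N ->
  coprime_forms d u -> irred E -> evalZ u E = 0 -> evalZ u G = 0 -> dvds E G.
Proof.
move=> d0 hu irE uE uG; apply: NNPP => nEG.
have [s ss ns] := coprime_forms_indep d0 hu.
have sV : (s^-1 = s)%g by rewrite -[RHS]mul1g -(mulVg s) -mulgA ss mulg1.
have sK : cancel (permX s) (permX s) by have := @permXK s; rewrite sV.
have permM x y : permX s (x * y) = permX s x * permX s y by apply: rmorphM.
have permD x y : permX s (x + y) = permX s x + permX s y by apply: rmorphD.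
have [|r [H [L [r0 er]]]] :=
    mpoly_eliminate (irred_iso sK sK irE) (G := permX s G).
  case=> c ec; apply: nEG; exists (permX s c).
  by apply: (can_inj sK); rewrite permM ec sK.
have ev0 x y : evalZ u (x * E + y * G) = 0.
  exact: (rmorph_comb0 (f := evalZ u) x y uE uG).
have : evalZ (u \o s) (mwiden r) = 0.
  rewrite -evalZ_permX er.
  rewrite permD !permM (sK E) (sK G); apply: ev0.
rewrite evalZ_mwiden => /(evalZ_binary r0) /=.
have -> : widen_ord (leqnSn 2) 1 = 1 by apply: val_inj.
by have -> : widen_ord (leqnSn 2) 0 = 0 by apply: val_inj.
Qed.

End Parametrization.

(** * Bihomogeneous components *)

Section Components.

Lemma dhomogC n (R : nzRingType) (c : R) : c%:MP_[n] \is 0.-homog.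
Proof.
apply/dhomogP => m; rewrite msuppC; case: ifP => // _.
by rewrite inE => /eqP ->; exact: mdeg0.
Qed.

Lemma mcoeff_pihomog n (R : nzRingType) d (p : {mpoly R[n]}) m :
  (pihomog mdeg d p)@_m = if mdeg m == d then p@_m else 0.
Proof.
rewrite pihomogE raddf_sum /= -big_filter.
have [mp|mp] := boolP (m \in [seq m' <- msupp p | mdeg m' == d]).
  rewrite (bigD1_seq m) ?filter_uniq ?msupp_uniq //=.
  rewrite big1 ?addr0 => [|m' nm]; last by rewrite mcoeffZ mcoeffX (negPf nm) mulr0.
  by move: mp; rewrite mem_filter mcoeffZ mcoeffX eqxx mulr1 => /andP[-> _].
rewrite big_seq big1 => [|m' m'p].
  move: mp; rewrite mem_filter negb_and => /orP[/negPf->//|mp].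
  by rewrite (memN_msupp_eq0 mp) if_same.
rewrite mcoeffZ mcoeffX; case: eqP => [e|_]; last by rewrite mulr0.
by rewrite -e m'p in mp.
Qed.

Lemma pihomog_mulr n (R : comNzRingType) b (p q : {mpoly R[n]}) i :
  q \is b.-homog ->
  pihomog mdeg i (p * q) = if (b <= i)%N then pihomog mdeg (i - b) p * q else 0.
Proof.
move=> hq; have [k [pk ik]] : exists k, (msize p <= k)%N /\ (i < k)%N.
  by exists (maxn (msize p) i.+1); rewrite leq_maxl leq_maxr.
rewrite {1}(pihomog_partitionE pk) mulr_suml raddf_sum /=.
have h (l : 'I_k) : (pihomog mdeg l p * q) \is (l + b).-homog.
  by apply: dhomogM => //; apply: pihomogP.
have [lbi|lib] := leqP b i.
  have lt : (i - b < k)%N by apply: leq_ltn_trans ik; apply: leq_subr.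
  rewrite (bigD1 (Ordinal lt)) //= big1 ?addr0 => [|l nl].
    by rewrite pihomog_dE //; have := h (Ordinal lt); rewrite /= subnK.
  apply: (pihomog_ne0 _ (h l)); apply: contra nl => /eqP e.
  by rewrite -val_eqE /= -e addnK.
rewrite big1 // => l _; apply: (pihomog_ne0 _ (h l)).
by rewrite neq_ltn (leq_trans lib) ?orbT ?leq_addl.
Qed.

Variable K : closedFieldType.
Implicit Types P Q : {mpolyTX K}.

(** No condition on the X-degree: cofactors in K[X] arising from divisibility by [E] or from the
    ideal of a point need not be homogeneous. *)
Definition Thomog i P := forall m, P@_m \is i.-homog.

Definition Tcomp i P : {mpolyTX K} := map_mpoly (pihomog mdeg i) P.

HB.instance Definition _ i := GRing.Additive.copy (Tcomp i) (map_mpoly (pihomog mdeg i)).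

Lemma mcoeff_Tcomp i P m : (Tcomp i P)@_m = pihomog mdeg i P@_m.
Proof. exact: mcoeff_map_mpoly. Qed.

Lemma Tcomp_Thomog i P : Thomog i (Tcomp i P).
Proof. by move=> m; rewrite mcoeff_Tcomp; apply: pihomogP. Qed.

Lemma Tcomp_id i P : Thomog i P -> Tcomp i P = P.
Proof. by move=> hP; apply/mpolyP => m; rewrite mcoeff_Tcomp pihomog_dE. Qed.

Lemma Tcomp_mulr b P Q i : Thomog b Q ->
  Tcomp i (P * Q) = if (b <= i)%N then Tcomp (i - b) P * Q else 0.
Proof.
move=> hQ; apply/mpolyP => m; rewrite mcoeff_Tcomp.
rewrite mcoeffM raddf_sum /=.
under eq_bigr => k _ do rewrite (pihomog_mulr _ _ (hQ _)).
have [lbi|lib] := leqP b i; last by rewrite big1 // mcoeff0.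
by rewrite mcoeffM; apply: eq_bigr => k _; rewrite mcoeff_Tcomp.
Qed.

Definition bicomp i j P : {mpolyTX K} := pihomog mdeg j (Tcomp i P).

HB.instance Definition _ i j :=
  GRing.Additive.copy (bicomp i j) (pihomog mdeg j \o Tcomp i).

Lemma bicomp_bihomog i j P : bihomog i j (bicomp i j P).
Proof.
split=> [|m]; first exact: pihomogP.
rewrite mcoeff_pihomog; case: eqP => _; last exact: dhomog0.
exact: Tcomp_Thomog.
Qed.

Lemma bicomp_id i j P : bihomog i j P -> bicomp i j P = P.
Proof. by case=> hX hT; rewrite /bicomp Tcomp_id // pihomog_dE. Qed.

Lemma bicomp_ne0 i j a b P : bihomog a b P -> (a, b) != (i, j) -> bicomp i j P = 0.
Proof.
case=> hX hT; rewrite xpair_eqE negb_and /bicomp => ne; apply/mpolyP => m.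
rewrite mcoeff_pihomog mcoeff0; case: eqP => // em; rewrite mcoeff_Tcomp.
case/orP: ne => ne; first by rewrite (pihomog_ne0 ne (hT m)).
have -> : P@_m = 0 by apply: (dhomog_nemf_coeff hX); apply: contra ne => /eqP <-; apply/eqP.
exact: pihomog0.
Qed.

Lemma bicomp_mulr a b P Q i j : bihomog a b Q ->
  bicomp i j (P * Q) =
    if (a <= i)%N && (b <= j)%N then bicomp (i - a) (j - b) P * Q else 0.
Proof.
case=> hX hT; rewrite /bicomp (Tcomp_mulr _ _ hT).
case: (a <= i)%N; last by rewrite raddf0.
exact: pihomog_mulr.
Qed.

Lemma bihomogD i j P Q : bihomog i j P -> bihomog i j Q -> bihomog i j (P + Q).
Proof.
move=> [hX hT] [hX' hT']; split=> [|m]; first exact: rpredD.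
by rewrite mcoeffD rpredD.
Qed.

Lemma bihomogN i j P : bihomog i j P -> bihomog i j (- P).
Proof.
move=> [hX hT]; split=> [|m]; first by rewrite rpredN.
by rewrite mcoeffN rpredN.
Qed.

Lemma ThomogD i P Q : Thomog i P -> Thomog i Q -> Thomog i (P + Q).
Proof. by move=> hP hQ m; rewrite mcoeffD rpredD. Qed.

Lemma ThomogN i P : Thomog i P -> Thomog i (- P).
Proof. by move=> hP m; rewrite mcoeffN rpredN. Qed.

Lemma ThomogM i j P Q : Thomog i P -> Thomog j Q -> Thomog (i + j) (P * Q).
Proof.
move=> hP hQ m; rewrite mcoeffM rpred_sum // => k _.
exact: dhomogM.
Qed.

Lemma bihomogM i j a b P Q : bihomog i j P -> bihomog a b Q ->
  bihomog (i + a) (j + b) (P * Q).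
Proof. by move=> [hX hT] [hX' hT']; split; [apply: dhomogM | apply: ThomogM]. Qed.

Lemma Thomog_ofX (G : {mpoly K[3]}) : Thomog 0 (ofX G).
Proof.
move=> m; rewrite mcoeff_map_mpoly; exact: dhomogC.
Qed.

Lemma bihomog_ofX j (G : {mpoly K[3]}) : G \is j.-homog -> bihomog 0 j (ofX G).
Proof.
move=> /dhomogP hG; split; last exact: Thomog_ofX.
apply/dhomogP => m; rewrite mcoeff_msupp mcoeff_map_mpoly mpolyC_eq0.
by rewrite -mcoeff_msupp => /hG.
Qed.

Lemma bihomog_Tvar l : bihomog 1 0 (Tvar K l).
Proof.
split=> [|m]; rewrite /Tvar; first exact: dhomogC.
rewrite mcoeffC; case: eqP => _; last by rewrite mulr0 dhomog0.
by rewrite mulr1 dhomogX; apply/eqP; exact: mdeg1.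
Qed.

Lemma Thomog_expT l i : Thomog i (Tvar K l ^+ i).
Proof.
elim: i => [|i IH]; first by rewrite expr0 -[1](rmorph1 (@ofX K)); exact: Thomog_ofX.
by rewrite exprS -add1n; apply: ThomogM => //; case: (bihomog_Tvar l).
Qed.

(** The point (1:0). A form that vanishes there is divisible by ['X_1], which drives every descent
    on the T-degree. *)
Definition pt10 (i : 'I_2) : K := (i == 0)%:R.

Definition at10 : {mpolyTX K} -> {mpoly K[3]} := map_mpoly (meval pt10).

HB.instance Definition _ := GRing.RMorphism.copy at10 (map_mpoly (meval pt10)).

(** For [f] homogeneous of degree i + 1, this is the quotient by ['X_1] of [f] minus its
    ['X_0 ^+ i.+1] term. The formula by coefficients makes it additive on all polynomials, so it
    applies coefficientwise to K[T][X]. *)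
Definition lowT i (f : {mpoly K[2]}) : {mpoly K[2]} :=
  \sum_(l < i.+1) f@_(mnm2 l (i.+1 - l)) *: ('X_0 ^+ l * 'X_1 ^+ (i - l)).

Lemma lowT_is_additive i : additive (lowT i).
Proof.
move=> f g; rewrite /lowT -sumrB; apply: eq_bigr => l _.
by rewrite mcoeffB scalerBl.
Qed.

HB.instance Definition _ i :=
  GRing.isAdditive.Build {mpoly K[2]} {mpoly K[2]} (lowT i) (lowT_is_additive i).

Lemma lowT_homog i f : lowT i f \is i.-homog.
Proof.
apply: rpred_sum => l _; rewrite rpredZ // -mpolyX2 dhomogX; apply/eqP.
by apply: (etrans (mdeg2E _)); rewrite mnm2_0 mnm2_1 subnKC // -ltnS.
Qed.

Lemma meval10 i f : f \is i.-homog -> f.@[pt10] = f@_(mnm2 i 0).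
Proof.
move=> hf; rewrite {1}(binary_formE hf) raddf_sum /= big_ord_recr /=.
rewrite big1 ?add0r => [|l _].
  by rewrite subnn mevalZ mevalM !rmorphXn /= !mevalXU /pt10 eqxx expr1n expr0 !mulr1.
by rewrite mevalZ mevalM !rmorphXn /= !mevalXU /pt10 eqxx
  expr0n subn_eq0 leqNgt ltn_ord mulr0 mulr0.
Qed.
End Components.

(** * Substituting F for T *)

Section Decomposition.
Variable K : closedFieldType.
Implicit Types P Q : {mpolyTX K}.

Lemma form_decomp i (f : {mpoly K[2]}) : f \is i.+1.-homog ->
  f = (f.@[@pt10 K])%:MP * 'X_0 ^+ i.+1 + 'X_1 * lowT i f.
Proof.
move=> hf; rewrite {1}(binary_formE hf) big_ord_recr /= addrC; congr (_ + _).
  by rewrite subnn expr0 mulr1 (meval10 hf) mul_mpolyC.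
rewrite /lowT mulr_sumr; apply: eq_bigr => l _.
by rewrite -scalerAr mulrCA subSn -1?ltnS // exprS.
Qed.

Lemma mcoeff_ofX_expT (G : {mpoly K[3]}) l i m :
  (ofX G * Tvar K l ^+ i)@_m = (G@_m)%:MP * 'X_l ^+ i.
Proof.
rewrite mulrC /Tvar -rmorphXn mcoeffCM mulrC; congr (_ * _).
exact: mcoeff_map_mpoly.
Qed.

Lemma Thomog_decomp i P : Thomog i.+1 P -> exists2 P', Thomog i P' &
  P = ofX (at10 P) * Tvar K 0 ^+ i.+1 + Tvar K 1 * P'.
Proof.
move=> hP; exists (map_mpoly (lowT i) P) => [m|].
  by rewrite (mcoeff_map_mpoly (lowT i) m); apply: lowT_homog.
apply/mpolyP => m; rewrite mcoeffD mcoeff_ofX_expT mcoeffCM.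
rewrite (mcoeff_map_mpoly (lowT i) m) [in RHS]/at10 (mcoeff_map_mpoly (meval _) m).
exact: form_decomp.
Qed.

Lemma Thomog0_ofX P : Thomog 0 P -> P = ofX (at10 P).
Proof.
move=> hP; apply/mpolyP => m.
rewrite (mcoeff_map_mpoly (@mpolyC 2 K) m) (mcoeff_map_mpoly (meval _) m).
rewrite {1}(binary_formE (hP m)) big_ord1 /= (meval10 (hP m)).
by rewrite !expr0 mulr1 -mul_mpolyC mulr1.
Qed.

Lemma mmap_scaleT (B : comNzRingType) (phi : K -> B) t x (z : B) i P :
  Thomog i P -> mmap (mmap phi (fun j => z * t j)) x P =
                z ^+ i * mmap (mmap phi t) x P.
Proof.
move=> hP; transitivity (\sum_(m <- msupp P) z ^+ i * (mmap phi t P@_m * mmap1 x m)).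
  by apply: eq_bigr => m _; rewrite (mmap_homog phi t z (hP m)) mulrA.
by rewrite -mulr_sumr.
Qed.

End Decomposition.

Lemma rmorph_mmap n (R S B : nzRingType) (g : {rmorphism S -> B}) (h : R -> S)
    (x : 'I_n -> S) P : g (mmap h x P) = mmap (g \o h) (g \o x) P.
Proof.
rewrite /mmap rmorph_sum; apply: eq_bigr => m _.
by rewrite rmorphM rmorph_prod; congr (_ * _); apply: eq_bigr => i _; rewrite rmorphXn.
Qed.

Lemma rmorph_cross (A : pzRingType) (B : comPzRingType) (f : {rmorphism A -> B})
    (t0 t1 x0 x1 : A) : f t0 = f x0 -> f t1 = f x1 -> f (t0 * x1 - t1 * x0) = 0.
Proof. by move=> e0 e1; rewrite rmorphB !rmorphM e0 e1 mulrC subrr. Qed.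

(* One step of division by t0 f1 - t1 f0, followed by division by t1. *)
Lemma reduce_step (A R : comPzRingType) (ev : {rmorphism A -> R})
    (iota : {rmorphism R -> A}) (t0 t1 p P : A) (f0 f1 c : R) i :
  cancel iota ev -> ev t0 = f0 -> ev t1 = f1 ->
  (forall x, f1 * x = 0 -> x = 0) ->
  P = iota (f1 * c) * t0 ^+ i.+1 + t1 * p -> ev P = 0 ->
  let p' := p + iota c * t0 ^+ i * iota f0 in
  ev p' = 0 /\
  P = (t0 * iota f1 - t1 * iota f0) * (iota c * t0 ^+ i) + t1 * p'.
Proof.
move=> ik e0 e1 reg eP evP p'; split; last by rewrite eP rmorphM /p' exprS; ring.
apply: reg; rewrite -[RHS]evP eP /p' !rmorphD !rmorphM /= !rmorphXn !ik e0 e1 exprS.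
by rewrite /=; ring.
Qed.

Lemma factor_comb (A : comPzRingType) (x y z t : A) :
  x * y + t * (x * z) = x * (y + t * z).
Proof. by ring. Qed.

Lemma rmorph_dvd_step (A R : comPzRingType) (ev : {rmorphism A -> R})
    (iota : {rmorphism R -> A}) (t0 t1 p P : A) (f0 f1 c : R) i :
  cancel iota ev -> ev t0 = f0 -> ev t1 = f1 ->
  P = iota c * t0 ^+ i + t1 * p -> ev P = 0 -> c * f0 ^+ i = f1 * - ev p.
Proof.
move=> ik e0 e1 eP evP; apply/eqP; rewrite mulrN -addr_eq0 -evP eP.
by rewrite rmorphD !rmorphM rmorphXn ik e0 e1.
Qed.

Section Main.
Variable K : closedFieldType.
Variables (F : 'I_2 -> {mpoly K[3]}) (u : 'I_3 -> {mpoly K[2]}).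
Implicit Types P Q : {mpolyTX K}.

HB.instance Definition _ := GRing.RMorphism.copy (@ofX K) (map_mpoly (@mpolyC 2 K)).
HB.instance Definition _ := GRing.RMorphism.copy (evalT F)
  (mmap (subst F) (fun i : 'I_3 => 'X_i)).
HB.instance Definition _ := GRing.RMorphism.copy (rees_map u)
  (mmap (@polyC {mpoly K[2]}) (fun i => u i *: 'X)).

Lemma evalT_ofX G : evalT F (ofX G) = G.
Proof.
apply: (mpoly_morph_ext (f := evalT F \o @ofX K) (g := idfun)) G => [c|i] /=.
  by rewrite /evalT /ofX map_mpolyC mmapC; apply: subst_C.
by rewrite /evalT /ofX map_mpolyX mmapX mmap1U.
Qed.

Lemma evalT_Tvar l : evalT F (Tvar K l) = F l.
Proof. by rewrite /evalT /Tvar mmapC; apply: subst_X. Qed.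

Lemma rees_map_ofX G : rees_map u (ofX G) = evalZ u G.
Proof.
apply: (mpoly_morph_ext (f := rees_map u \o @ofX K) (g := evalZ u)) G => [c|i] /=.
  by rewrite /rees_map /ofX map_mpolyC mmapC evalZ_C.
by rewrite /rees_map /ofX map_mpolyX mmapX mmap1U evalZ_X.
Qed.

Lemma rees_map_Tvar l : rees_map u (Tvar K l) = ('X_l)%:P.
Proof. by rewrite /rees_map /Tvar mmapC. Qed.

Lemma evalTB P Q : evalT F (P - Q) = evalT F P - evalT F Q.
Proof. exact: rmorphB. Qed.

Lemma evalTM P Q : evalT F (P * Q) = evalT F P * evalT F Q.
Proof. exact: rmorphM. Qed.

Definition pencil : {mpolyTX K} :=
  Tvar K 0 * ofX (F 1) - Tvar K 1 * ofX (F 0).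

Lemma evalT_pencil : evalT F pencil = 0.
Proof.
have e l : evalT F (Tvar K l) = evalT F (ofX (F l)).
  by rewrite evalT_ofX evalT_Tvar.
exact: (rmorph_cross (e 0) (e 1)).
Qed.

Hypothesis hF : coprime_forms 2 F.

(** Were [F 1] zero, [F 0] would be a common factor, hence a unit, against its degree 2. *)
Lemma F_neq0_coprime : F 1 != 0 /\
  forall g, dvds g (F 1) -> dvds g (F 0) -> g \is a GRing.unit.
Proof.
have [hom cop] := hF.
have all2 (P : 'I_2 -> Prop) : P 0 -> P 1 -> forall i, P i.
  move=> P0 P1 i; have : i \in [:: 0; 1 : 'I_2] by case: i => [[|[|]]].
  by rewrite !inE => /orP[] /eqP ->.
split=> [|g g1 g0]; last by apply: cop; apply: all2; [apply: g0 | apply: g1].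
apply/negP => /eqP F1.
have /mpoly_unitP[c c0 e] : F 0 \is a GRing.unit.
  apply: cop; apply: all2; first by exists 1; rewrite mulr1.
  by exists 0; rewrite mulr0.
have F00 : F 0 != 0 by rewrite e mpolyC_eq0.
have h0 : F 0 \is 0.-homog by rewrite e; apply: dhomogC.
by have := dhomog_uniq F00 (hom 0) h0.
Qed.

(** Induction on the T-degree. Vanishing at T = F shows that [F 1] divides [at10 P * F 0 ^+ i.+1],
    hence [at10 P] by coprimality. A multiple of the pencil then cancels the pure power of the first
    variable, and the quotient of the rest by the second one again vanishes at T = F. *)
Lemma evalT_eq0 i P : Thomog i P -> evalT F P = 0 -> exists M, P = pencil * M.
Proof.
have [F1 cop] := F_neq0_coprime.
elim: i P => [|i IH] P hP.
  rewrite (Thomog0_ofX hP) evalT_ofX => ->; exists 0.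
  exact: (etrans (rmorph0 (@ofX K)) (esym (mulr0 _))).
have [P' hP' eP] := Thomog_decomp hP => evP.
have [c ec] : dvds (F 1) (at10 P).
  apply: (euclid (@mpoly_atomic _ _) (@mpoly_irred_prime _ _) (n := i.+1) cop) => //.
  exists (- evalT F P').
  exact: (rmorph_dvd_step evalT_ofX (evalT_Tvar 0) (evalT_Tvar 1) eP evP).
rewrite ec in eP.
have reg (x : {mpoly K[3]}) : F 1 * x = 0 -> x = 0.
  by move/eqP; rewrite mulf_eq0 (negPf F1) => /eqP.
have [] := reduce_step evalT_ofX (evalT_Tvar 0) (evalT_Tvar 1) reg eP evP.
set P2 := P' + _ => evP2 eP2.
have hP2 : Thomog i P2.
  have := ThomogM (ThomogM (Thomog_ofX c) (Thomog_expT K 0 i)) (Thomog_ofX (F 0)).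
  by rewrite add0n addn0; apply: ThomogD.
have [M eM] := IH _ hP2 evP2.
exists (ofX c * Tvar K 0 ^+ i + Tvar K 1 * M).
rewrite eP2 eM; exact: factor_comb.
Qed.

Hypothesis hFu : defines_inverse u F.

Lemma subst_cross : subst u (F 0) * 'X_1 = subst u (F 1) * 'X_0.
Proof.
apply/eqP; rewrite -subr_eq0; apply/eqP/mpoly_vanish => x.
by have [_ /(_ 0 1 x)] := hFu; apply.
Qed.

Lemma evalZ_cross l : evalZ u (F 0) * ('X_l)%:P = ('X_0)%:P * evalZ u (F l).
Proof.
have [hom _] := hF; rewrite !(evalZ_homog u (hom _)).
rewrite -!mul_polyC mulrAC -polyCM mulrA -polyCM; congr (_ %:P * _).
have : l \in [:: 0; 1 : 'I_2] by case: l => [[|[|]]].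
by rewrite !inE => /orP[] /eqP ->; rewrite ?subst_cross mulrC.
Qed.

Lemma evalZ_subst G : evalZ u (subst F G) =
  mmap (polyC \o @mpolyC 2 K) (fun j => evalZ u (F j)) G.
Proof.
apply: (mpoly_morph_ext (f := evalZ u \o subst F)
  (g := mmap (polyC \o @mpolyC 2 K) (fun j => evalZ u (F j)))) G => [c|i] /=.
  by rewrite subst_C evalZ_C mmapC.
by rewrite subst_X mmapX mmap1U.
Qed.

Lemma polyC_mmap (G : {mpoly K[2]}) : G%:P =
  mmap (polyC \o @mpolyC 2 K) (fun j => ('X_j)%:P) G.
Proof.
apply: (mpoly_morph_ext (f := polyC)
  (g := mmap (polyC \o @mpolyC 2 K) (fun j => ('X_j)%:P))) G => [c|i] /=.
  by rewrite mmapC.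
by rewrite mmapX mmap1U.
Qed.

(** The vectors T and F(uZ) are proportional, by [evalZ_cross]; since [P] is homogeneous in T, one
    may be exchanged for the other at the cost of the scaling factors. *)
Lemma evalZ_evalT i P : Thomog i P ->
  evalZ u (F 0) ^+ i * rees_map u P = ('X_0)%:P ^+ i * evalZ u (evalT F P).
Proof.
move=> hP.
have -> : rees_map u P = mmap (mmap (polyC \o @mpolyC 2 K) (fun j => ('X_j)%:P))
    (fun i => u i *: 'X) P.
  by apply: eq_bigr => m _; rewrite [X in X * _]polyC_mmap.
have -> : evalZ u (evalT F P) = mmap (mmap (polyC \o @mpolyC 2 K)
    (fun j => evalZ u (F j))) (fun i => u i *: 'X) P.
  apply: etrans (rmorph_mmap (evalZ u) _ _ _) _; apply: eq_bigr => m _.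
  by rewrite [X in X * _]evalZ_subst; congr (_ * _); apply: mmap1_eq => l; apply: evalZ_X.
rewrite -!(mmap_scaleT _ _ _ _ hP); apply: eq_bigr => m _; congr (_ * _).
apply: mmap_eq => l; exact: evalZ_cross.
Qed.

Lemma rees_evalZ i P : Thomog i P -> P \in rees_ideal u -> evalZ u (evalT F P) = 0.
Proof.
move=> hP /eqP rP; have := evalZ_evalT hP; rewrite rP mulr0 => /esym/eqP.
rewrite mulf_eq0 expf_eq0 polyC_eq0 -msize_poly_eq0 msizeX andbF /=.
by move/eqP.
Qed.

End Main.

(** * Syzygies *)

Section LinearAlgebra.
Variable K : fieldType.

Lemma linear_system (I J : finType) (a : I -> J -> K) : (#|J| < #|I|)%N ->
  exists x : I -> K, (exists i, x i != 0) /\ forall j, \sum_i x i * a i j = 0.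
Proof.
move=> ltJI; pose A := \matrix_(i < #|I|, j < #|J|) a (enum_val i) (enum_val j).
have nz : nz_row (kermx A) != 0.
  rewrite nz_row_eq0 kermx_eq0 /row_free neq_ltn.
  by rewrite (leq_ltn_trans (rank_leq_col A)).
have : (nz_row (kermx A) <= kermx A)%MS by exact: nz_row_sub.
move: (nz_row _) nz => v v0 /sub_kermxP vA.
exists (fun i => v 0 (enum_rank i)); split.
  have [i vi] : exists i, v 0 i != 0.
    apply: NNPP => nex; case/eqP: v0; apply/rowP => i; rewrite mxE.
    by apply/eqP/negPn/negP => vi; apply: nex; exists i.
  by exists (enum_val i); rewrite enum_valK.
move=> j; have /rowP/(_ (enum_rank j)) := vA; rewrite !mxE => e.
rewrite -[RHS]e (reindex (@enum_val _ I)) /=.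
  by apply: eq_bigr => i _; rewrite enum_valK mxE enum_rankK.
by exists enum_rank => i _; [apply: enum_valK | apply: enum_rankK].
Qed.

Definition lin_indep n (p q : 'rV[K]_n) : Prop :=
  forall a b, a *: p + b *: q = 0 -> a = 0 /\ b = 0.

Lemma lin_indep_minor n (p q : 'rV[K]_n) : lin_indep p q ->
  exists i j, p 0 i * q 0 j - p 0 j * q 0 i != 0.
Proof.
move=> ind; apply: NNPP => nex.
have z i j : p 0 i * q 0 j = p 0 j * q 0 i.
  apply/eqP; rewrite -subr_eq0; apply/negPn/negP => ne; apply: nex.
  by exists i, j.
have p0 i : p 0 i = 0.
  (* The vanishing minors of column [i] state that this combination of [p] and [q] is zero. *)
  suff /ind[_ ] : (- q 0 i) *: p + p 0 i *: q = 0 by [].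
  by apply/rowP => j; rewrite !mxE z; ring.
have p00 : p = 0 by apply/rowP => i; rewrite mxE.
have [] := ind 1 0 _; first by rewrite p00 scaler0 scale0r addr0.
by move/eqP; rewrite oner_eq0.
Qed.

(** The span of [p] and [q] lies in the orthogonal of [w], and both have dimension 2. *)
Lemma orthogonal_span (w p q l : 'rV[K]_3) : w != 0 -> lin_indep p q ->
  p *m w^T = 0 -> q *m w^T = 0 -> l *m w^T = 0 ->
  exists a b, l = a *: p + b *: q.
Proof.
move=> w0 ind pw qw lw; pose M := col_mx p q.
have frM : row_free M.
  rewrite -kermx_eq0; apply/eqP/row_matrixP => i; rewrite row0.
  set v := row i _; have : v *m M = 0 by rewrite /v -row_mul mulmx_ker row0.
  rewrite -[v]hsubmxK mul_row_col [lsubmx v]mx11_scalar [rsubmx v]mx11_scalar.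
  rewrite !mul_scalar_mx => /ind[-> ->].
  by apply/rowP => j; rewrite !mxE; case: splitP => k _; rewrite !mxE; case: eqP.
have Mk : (M <= kermx w^T)%MS by apply/sub_kermxP; rewrite mul_col_mx pw qw col_mx0.
have rk : \rank (kermx w^T) = 2.
  by rewrite mxrank_ker mxrank_tr rank_rV w0.
have /eqmxP eM : (M == kermx w^T)%MS.
  by rewrite -(mxrank_leqif_eq Mk) rk (eqP frM).
have /submxP[v ev] : (l <= M)%MS by rewrite eM; apply/sub_kermxP.
exists (lsubmx v 0 0), (rsubmx v 0 0).
rewrite ev -[v in LHS]hsubmxK mul_row_col.
by rewrite [lsubmx v]mx11_scalar [rsubmx v]mx11_scalar !mul_scalar_mx !mxE !eqxx !mulr1n.
Qed.

End LinearAlgebra.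

Section Degrees.
Variable K : closedFieldType.

Lemma subst_homog n m e d (f : 'I_m -> {mpoly K[n]}) G :
  (forall i, f i \is e.-homog) -> G \is d.-homog -> subst f G \is (e * d).-homog.
Proof.
move=> hf /dhomogP hG; rewrite substE /mmap big_seq rpred_sum // => k /hG <-.
rewrite mul_mpolyC rpredZ // [X in (e * X)%N](mdegE k) big_distrr /=.
apply: (big_ind2 (fun (x : {mpoly K[n]}) l => x \is l.-homog)).
- exact: dhomog1.
- by move=> x i y j; apply: dhomogM.
- by move=> i _; apply: dhomogMn.
Qed.

Lemma evalT_homog e (F : 'I_2 -> {mpoly K[3]}) i j (P : {mpolyTX K}) :
  (forall l, F l \is e.-homog) ->
  bihomog i j P -> evalT F P \is (e * i + j).-homog.
Proof.
move=> hF [/dhomogP hX hT]; rewrite /evalT /mmap big_seq rpred_sum // => m /hX <-.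
apply: dhomogM; first exact: subst_homog.
by rewrite mmap1_id dhomogX; apply/eqP.
Qed.

Lemma homog_msizeE n d (f : {mpoly K[n]}) : f != 0 -> f \is d.-homog -> msize f = d.+1.
Proof. by move=> f0 /dhomogP hf; rewrite -mlead_deg // (hf _ (mlead_supp f0)). Qed.

Lemma dvds_homog_lt n d e (E G : {mpoly K[n]}) : E != 0 -> E \is d.-homog ->
  G \is e.-homog -> (e < d)%N -> dvds E G -> G = 0.
Proof.
move=> E0 hE hG ed [H eG]; apply/eqP/negPn/negP => G0.
have H0 : H != 0 by apply: contraNneq G0 => H0; rewrite eG H0 mulr0.
have := msizeM E0 H0; rewrite -eG (homog_msizeE G0 hG) (homog_msizeE E0 hE).
have := mpolySpred mdeg H0; case: (msize H) => // s _.
rewrite addSn addnS /= => -[es].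
by move: ed; rewrite es ltnNge leq_addr.
Qed.

Lemma dvds_homog_eq n d (E G : {mpoly K[n]}) : E != 0 -> E \is d.-homog ->
  G \is d.-homog -> dvds E G -> exists c, G = c *: E.
Proof.
move=> E0 hE hG [H eG]; have [G0|G0] := eqVneq G 0.
  by exists 0; rewrite G0 scale0r.
have H0 : H != 0 by apply: contraNneq G0 => H0; rewrite eG H0 mulr0.
have := msizeM E0 H0; rewrite -eG (homog_msizeE G0 hG) (homog_msizeE E0 hE).
have := mpolySpred mdeg H0; case es: (msize H) => [|s] // _.
rewrite addSn addnS /= => -[/esym/eqP]; rewrite -[X in _ == X]addn0 eqn_add2l => /eqP s0.
have /msize_poly1P[c _ eH] : msize H == 1 by rewrite es s0.
exists c.
by rewrite eG mulrC eH mul_mpolyC.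
Qed.

End Degrees.

(** * Syzygies of the parameterization, by descent at the point (1:0) *)

Section Curve.
Variables (K : closedFieldType) (d k : nat) (u : 'I_3 -> {mpoly K[2]})
  (E : {mpoly K[3]}) (F : 'I_2 -> {mpoly K[3]}).
Hypotheses (dk : d = (2 * k)%N) (k_gt1 : (1 < k)%N) (hu : coprime_forms d u)
  (hE : E \is d.-homog) (irE : irred E) (uE : evalZ u E = 0)
  (hF : coprime_forms 2 F) (hFu : defines_inverse u F).
Implicit Types (P Q : {mpolyTX K}) (a p q : 'rV[{mpoly K[2]}]_3).

Let d_gt0 : (0 < d)%N. Proof. by rewrite dk mul2n double_gt0 ltnW. Qed.
Let E0 : E != 0. Proof. by case: irE. Qed.

Lemma rees_dvds i P : Thomog i P -> P \in rees_ideal u -> dvds E (evalT F P).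
Proof.
move=> hP rP; apply: (implicit_equation_dvds d_gt0 hu irE uE).
exact: (rees_evalZ hF hFu hP rP).
Qed.

Lemma bihomog_pencil : bihomog 1 2 (pencil F).
Proof.
have [hF2 _] := hF.
apply: bihomogD; last apply: bihomogN.
  exact: (bihomogM (bihomog_Tvar K 0) (bihomog_ofX (hF2 1))).
exact: (bihomogM (bihomog_Tvar K 1) (bihomog_ofX (hF2 0))).
Qed.

(** Projecting to bidegree (i, j) makes the cofactor bihomogeneous; nothing survives unless (i, j)
    dominates (1, 2). *)
Lemma pencil_mul_bihomog i j P M : bihomog i j P -> P = pencil F * M ->
  P = if (1 <= i)%N && (2 <= j)%N then bicomp (i - 1) (j - 2) M * pencil F else 0.
Proof.
move=> hP eP; rewrite -(bicomp_mulr _ _ _ bihomog_pencil) -[LHS](bicomp_id hP) eP.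
by congr (bicomp _ _ _); apply: mulrC.
Qed.

Lemma mcoeff_syz_form a (l : 'I_3) : (syz_form a)@_U_(l) = a 0 l.
Proof.
rewrite /syz_form raddf_sum (bigD1 l) //= big1 ?addr0 => [|i il].
  by rewrite mcoeffZ mcoeffX eqxx mulr1.
by rewrite mcoeffZ mcoeffX eq_mnm1 (negPf il) mulr0.
Qed.

Lemma syz_form_bihomog i a : homog_syz i a -> bihomog i 1 (syz_form a).
Proof.
move=> ha; split.
  rewrite rpred_sum // => l _; rewrite rpredZ // dhomogX; apply/eqP; exact: mdeg1.
move=> m; rewrite /syz_form raddf_sum /= rpred_sum // => l _.
by rewrite mcoeffZ mcoeffX; case: eqP => _; rewrite ?mulr1 ?mulr0 ?rpred0 //; apply: ha.
Qed.

Lemma rees_syz_form a : rees_map u (syz_form a) = (\sum_i a 0 i * u i) *: 'X.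
Proof.
rewrite /syz_form (rmorph_sum (rees_map u)) scaler_suml; apply: eq_bigr => i _.
rewrite [LHS]/= /rees_map mmapZ mmapX mmap1U.
by rewrite mul_polyC scalerA.
Qed.

Lemma syz_form_rees a : syz_form a \in rees_ideal u <-> syzygy u a.
Proof.
rewrite /syzygy; split=> [/eqP|e].
  move/(congr1 (fun h : {poly {mpoly K[2]}} => h`_1)); rewrite rees_syz_form.
  by rewrite coefZ coefX mulr1 coef0.
by apply/eqP; rewrite rees_syz_form e scale0r.
Qed.

Lemma syz_low_degree i a : homog_syz i a -> (i < k)%N -> syzygy u a -> a = 0.
Proof.
move=> ha ik /syz_form_rees ra; have hP := syz_form_bihomog ha.
have [hF2 _] := hF.
have eP : evalT F (syz_form a) = 0.
  apply: (dvds_homog_lt E0 hE (evalT_homog hF2 hP)); first by rewrite dk; lia.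
  by apply: (rees_dvds _ ra); case: hP => _; apply.
have [_ hT] := hP; have [M eM] := evalT_eq0 hF hT eP.
have := pencil_mul_bihomog hP eM; rewrite andbF => P0.
by apply/rowP => l; rewrite -mcoeff_syz_form P0 mcoeff0 mxE.
Qed.

Lemma sum_scale_syz s a : \sum_i (s *: a) 0 i * u i = s * \sum_i a 0 i * u i.
Proof. by rewrite mulr_sumr; apply: eq_bigr => i _; rewrite mxE mulrA. Qed.

Lemma syzygyZ s a : syzygy u a -> syzygy u (s *: a).
Proof. by rewrite /syzygy sum_scale_syz => ->; rewrite mulr0. Qed.

Lemma syzygyD a p : syzygy u a -> syzygy u p -> syzygy u (a + p).
Proof.
rewrite /syzygy => sa sp.
under eq_bigr => i _ do rewrite mxE mulrDl.
by rewrite big_split /= sa sp addr0.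
Qed.

Definition ev10 : 'rV[{mpoly K[2]}]_3 -> 'rV[K]_3 := map_mx (meval (@pt10 K)).

Lemma ev10Z s a : ev10 (s *: a) = s.@[@pt10 K] *: ev10 a.
Proof. by apply/rowP => i; rewrite !mxE mevalM. Qed.

Lemma ev10D a p : ev10 (a + p) = ev10 a + ev10 p.
Proof. by apply/rowP => i; rewrite !mxE mevalD. Qed.

Lemma mpolyX_neq0 l : 'X_l != 0 :> {mpoly K[2]}.
Proof. by rewrite -msize_poly_eq0 msizeX mdeg1. Qed.

Lemma form_ev10_eq0 i (f : {mpoly K[2]}) : f \is i.+1.-homog -> f.@[@pt10 K] = 0 ->
  f = 'X_1 * lowT i f.
Proof. by move=> hf f0; rewrite {1}(form_decomp hf) f0 mpolyC0 mul0r add0r. Qed.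

(** Each entry is divisible by ['X_1], and this nonzero factor cancels from the syzygy relation. *)
Lemma syz_ev10_eq0 i a : homog_syz i.+1 a -> syzygy u a -> ev10 a = 0 ->
  exists b, [/\ homog_syz i b, syzygy u b & a = 'X_1 *: b].
Proof.
move=> ha sa a0; pose b := map_mx (lowT i) a.
have eab : a = 'X_1 *: b.
  apply/rowP => l; rewrite !mxE; apply: form_ev10_eq0 (ha l) _.
  by move/rowP/(_ l): a0; rewrite !mxE.
exists b; split=> //.
  by move=> l; rewrite mxE; apply: lowT_homog.
have := sa; rewrite /syzygy eab sum_scale_syz => /eqP.
by rewrite mulf_eq0 (negPf (mpolyX_neq0 1)) => /eqP.
Qed.

(** Otherwise ['X_1] would be a common factor of the [u i]. *)
Lemma ev10_u_neq0 : \row_i (u i).@[@pt10 K] != 0.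
Proof.
have [hu2 cop] := hu; apply/negP => /eqP/rowP u0.
have dS : d = d.-1.+1 by rewrite prednK.
have : 'X_1 \is a @GRing.unit {mpoly K[2]}.
  apply: cop => i; exists (lowT d.-1 (u i)); apply: form_ev10_eq0.
    by rewrite -dS.
  by have := u0 i; rewrite !mxE.
case/mpoly_unitP => c c0 e.
by have := msizeX K U_(1%R : 'I_2); rewrite e mdeg1 msizeC c0.
Qed.

Lemma ev10_orth a : syzygy u a -> ev10 a *m (\row_i (u i).@[@pt10 K])^T = 0.
Proof.
move=> sa; apply/rowP => j; rewrite !mxE.
have := congr1 (meval (@pt10 K)) sa; rewrite raddf_sum /= raddf0 => e.
by rewrite -[RHS]e; apply: eq_bigr => i _; rewrite !mxE mevalM.
Qed.

Section Basis.
Variables p q : 'rV[{mpoly K[2]}]_3.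
Hypotheses (hp : homog_syz k p) (hq : homog_syz k q)
  (sp : syzygy u p) (sq : syzygy u q)
  (ind : forall a b : K, a%:MP *: p + b%:MP *: q = 0 -> a = 0 /\ b = 0).

Lemma homog_syz_comb (a b : K) m :
  homog_syz (m + k) ('X_0 ^+ m *: (a%:MP *: p + b%:MP *: q)).
Proof.
move=> l; rewrite !mxE; apply: dhomogM.
  have hX : ('X_0 : {mpoly K[2]}) \is 1.-homog.
    by rewrite dhomogX; apply/eqP; exact: mdeg1.
  by have := dhomogMn m hX; rewrite mul1n.
by rewrite rpredD // mul_mpolyC rpredZ.
Qed.

Lemma syzygy_comb (a b : {mpoly K[2]}) : syzygy u (a *: p + b *: q).
Proof. by apply: syzygyD; apply: syzygyZ. Qed.

(** A combination that vanishes at (1, 0) is ['X_1] times a syzygy of degree k - 1, which is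
    zero. *)
Lemma ev10_indep : lin_indep (ev10 p) (ev10 q).
Proof.
move=> a b ab0; apply: ind; set w := _ + _.
have hw : homog_syz k w by move=> l; rewrite !mxE rpredD // mul_mpolyC rpredZ.
have w0 : ev10 w = 0 by rewrite /w ev10D !ev10Z !mevalC.
have kS : k = k.-1.+1 by rewrite prednK //; lia.
rewrite kS in hw; have [v [hv sv ->]] := syz_ev10_eq0 hw (syzygy_comb _ _) w0.
by rewrite (syz_low_degree hv) ?scaler0 //; lia.
Qed.

(** Induction on the degree. From degree [k] on, the values of [p] and [q] at (1, 0) span the
    orthogonal of u(1, 0), so a combination of [p] and [q] has the same value there as [a]; the
    difference is divisible by ['X_1]. *)
Lemma homog_syz_span m a : homog_syz m a -> syzygy u a ->
  exists s t : {mpoly K[2]}, a = s *: p + t *: q.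
Proof.
elim: m a => [|m IH] a ha sa.
  exists 0, 0; rewrite !scale0r addr0; apply: syz_low_degree ha _ sa; lia.
have [mk|km] := ltnP m.+1 k.
  exists 0, 0; rewrite !scale0r addr0; exact: syz_low_degree ha _ sa.
have [b [c ebc]] := orthogonal_span ev10_u_neq0 ev10_indep (ev10_orth sp)
  (ev10_orth sq) (ev10_orth sa).
(* This power raises the combination to degree m + 1 and takes the value 1 at (1, 0). *)
set x := 'X_0 ^+ (m.+1 - k) : {mpoly K[2]}.
set v := x *: (b%:MP *: p + c%:MP *: q).
have hv : homog_syz m.+1 v.
  by have := homog_syz_comb b c (m.+1 - k); rewrite subnK.
have sv : syzygy u v by apply/syzygyZ/syzygy_comb.
have evx : x.@[@pt10 K] = 1 by rewrite /x rmorphXn /= mevalXU /pt10 expr1n.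
have [w [hw sw eaw]] : exists w, [/\ homog_syz m w, syzygy u w & a + -1 *: v = 'X_1 *: w].
  apply: syz_ev10_eq0.
  - by move=> l; rewrite !mxE mulN1r rpredB //; have := hv l; rewrite !mxE.
  - exact: (syzygyD sa (syzygyZ _ sv)).
  - rewrite ev10D ev10Z /v ev10Z evx scale1r ev10D !ev10Z !mevalC ebc.
    by rewrite mevalN meval1 scaleN1r subrr.
have [s [t ew]] := IH w hw sw.
exists ('X_1 * s + x * b%:MP), ('X_1 * t + x * c%:MP).
have -> : a = 'X_1 *: w + v by rewrite -eaw scaleN1r subrK.
by rewrite ew /v !scalerDl !scalerDr !scalerA addrACA.
Qed.

(** The homogeneous components of a syzygy are syzygies, because all [u i] have the same degree. *)
Lemma syzygy_span a : syzygy u a -> exists s t : {mpoly K[2]}, a = s *: p + t *: q.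
Proof.
move=> sa; have [hu2 _] := hu.
pose c m := map_mx (pihomog mdeg m) a.
have [n hn] : exists n, forall l, (msize (a 0%R l) <= n)%N.
  exists (\max_l msize (a 0%R l)) => l; apply: leq_bigmax.
have -> : a = \sum_(m < n) c m.
  apply/rowP => l; rewrite summxE {1}(pihomog_partitionE (hn l)).
  by apply: eq_bigr => m _; rewrite mxE.
have span_c m : exists s t : {mpoly K[2]}, c m = s *: p + t *: q.
  apply: (homog_syz_span (m := m)); first by move=> l; rewrite mxE; apply: pihomogP.
  have := congr1 (pihomog mdeg (m + d)) sa; rewrite raddf_sum raddf0 /= => e.
  rewrite /syzygy -[RHS]e; apply: eq_bigr => l _.
  by rewrite mxE (pihomog_mulr _ _ (hu2 l)) leq_addl addnK.
apply: (big_ind (fun b => exists s t : {mpoly K[2]}, b = s *: p + t *: q)) => //.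
  by exists 0, 0; rewrite !scale0r addr0.
move=> b b' [s [t ->]] [s' [t' ->]]; exists (s + s'), (t + t').
by rewrite !scalerDl addrACA.
Qed.

(** Some 2 x 2 minor [m] is nonzero since its value at (1, 0) is; Cramer's rule gives [m * s = 0]
    and [m * t = 0]. *)
Lemma syz_free (s t : {mpoly K[2]}) : s *: p + t *: q = 0 -> s = 0 /\ t = 0.
Proof.
have [i [j]] := lin_indep_minor ev10_indep; rewrite !mxE -!mevalM -mevalB => m0.
set m := _ - _ in m0; have {}m0 : m != 0.
  by apply: contraNneq m0 => ->; rewrite meval0.
move=> /rowP e; have := e i; have := e j; rewrite !mxE => ej ei.
have sm : m * s = (s * p 0 i + t * q 0 i) * q 0 j - (s * p 0 j + t * q 0 j) * q 0 i.
  by rewrite /m; ring.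
have tm : m * t = p 0 i * (s * p 0 j + t * q 0 j) - p 0 j * (s * p 0 i + t * q 0 i).
  by rewrite /m; ring.
split; apply: (mulfI m0); rewrite mulr0.
  by rewrite sm ei ej !mul0r subrr.
by rewrite tm ei ej !mulr0 subrr.
Qed.

Lemma syz_basis_of_indep : syz_basis u p q.
Proof.
split=> [a|]; last exact: syz_free.
by split=> [/syzygy_span//|[s [t ->]]]; apply: syzygy_comb.
Qed.

End Basis.

End Curve.

(** * Existence of the syzygy basis and of Q by counting dimensions *)

Section Existence.
Variables (K : closedFieldType) (d k : nat) (u : 'I_3 -> {mpoly K[2]})
  (E : {mpoly K[3]}) (F : 'I_2 -> {mpoly K[3]}).
Hypotheses (dk : d = (2 * k)%N) (k_gt1 : (1 < k)%N) (hu : coprime_forms d u)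
  (hE : E \is d.-homog) (irE : irred E) (uE : evalZ u E = 0)
  (hF : coprime_forms 2 F) (hFu : defines_inverse u F).

Lemma binary_form_eq0 n (f : {mpoly K[2]}) : f \is n.-homog ->
  (forall l : 'I_n.+1, f@_(mnm2 l (n - l)) = 0) -> f = 0.
Proof.
by move=> hf f0; rewrite (binary_formE hf) big1 // => l _; rewrite f0 scale0r.
Qed.

Lemma mcoeff_mnm2_sum n (x : 'I_n.+1 -> K) (l : 'I_n.+1) :
  (\sum_(j < n.+1) x j *: 'X_[mnm2 j (n - j)])@_(mnm2 l (n - l)) = x l.
Proof.
rewrite raddf_sum (bigD1 l) //= big1 ?addr0 => [|j jl].
  by rewrite mcoeffZ mcoeffX eqxx mulr1.
rewrite mcoeffZ mcoeffX; case: eqP => [e|]; last by rewrite mulr0.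
by case/eqP: jl; apply: val_inj; rewrite /= -(mnm2_0 j (n - j)) e mnm2_0.
Qed.

Lemma mnm2_homog n (l : 'I_n.+1) : ('X_[mnm2 l (n - l)] : {mpoly K[2]}) \is n.-homog.
Proof.
rewrite dhomogX; apply/eqP; apply: (etrans (mdeg2E _)).
by rewrite mnm2_0 mnm2_1 subnKC // -ltnS.
Qed.

(** There are 3(k + 1) unknown coefficients and k + d + 1 = 3k + 1 equations, which leaves room for
    one further linear condition [c] and still a nonzero solution. *)
Lemma exists_syz (c : 'I_3 -> 'I_k.+1 -> K) :
  exists a : 'rV[{mpoly K[2]}]_3, [/\ a != 0, homog_syz k a, syzygy u a &
    \sum_i \sum_(l < k.+1) (a 0 i)@_(mnm2 l (k - l)) * c i l = 0].
Proof.
have [hu2 _] := hu.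
pose n := (k + d)%N.
pose I := ('I_3 * 'I_k.+1)%type; pose J := option 'I_n.+1.
pose w (i : I) (j : J) : K :=
  if j is Some r then ('X_[mnm2 i.2 (k - i.2)] * u i.1)@_(mnm2 r (n - r))
  else c i.1 i.2.
have [|x [[i xi] ex]] := @linear_system K _ _ w.
  by rewrite card_option card_prod !card_ord /n dk; lia.
pose a : 'rV[{mpoly K[2]}]_3 :=
  \row_i \sum_(l < k.+1) x (i, l) *: 'X_[mnm2 l (k - l)].
have ax j (l : 'I_k.+1) : (a 0 j)@_(mnm2 l (k - l)) = x (j, l).
  by rewrite mxE (mcoeff_mnm2_sum (fun l => x (j, l))).
have ha : homog_syz k a.
  by move=> j; rewrite mxE rpred_sum // => l _; rewrite rpredZ // mnm2_homog.
exists a; split=> //.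
- apply: contraNneq xi => a0; case: i => j l.
  by rewrite -ax a0 mxE mcoeff0.
- apply: (binary_form_eq0 (n := n)) => [|r].
    by rewrite rpred_sum // => j _; apply: dhomogM.
  rewrite -[RHS](ex (Some r)) raddf_sum /=.
  transitivity (\sum_i \sum_l x (i, l) * w (i, l) (Some r)); last first.
    by rewrite pair_bigA; apply: eq_bigr => -[].
  apply: eq_bigr => j _; rewrite mxE mulr_suml raddf_sum.
  by apply: eq_bigr => l _; rewrite /= -scalerAl mcoeffZ.
- rewrite -[RHS](ex None).
  transitivity (\sum_i \sum_l x (i, l) * w (i, l) None); last first.
    by rewrite pair_bigA; apply: eq_bigr => -[].
  by apply: eq_bigr => j _; apply: eq_bigr => l _; rewrite ax.
Qed.

Lemma exists_syz_basis : exists p q : 'rV[{mpoly K[2]}]_3,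
  [/\ syz_basis u p q, homog_syz k p & homog_syz k q].
Proof.
have [p [p0 hp sp _]] := exists_syz (fun _ _ => 0).
have [i [l pil]] : exists i (l : 'I_k.+1), (p 0 i)@_(mnm2 l (k - l)) != 0.
  apply: NNPP => nex; case/eqP: p0; apply/rowP => i; rewrite mxE.
  apply: (binary_form_eq0 (hp i)) => l; apply/eqP/negPn/negP => pil.
  by apply: nex; exists i, l.
(* The further condition kills a coefficient of [q] at a place where that of [p] is nonzero, which
   gives independence over K. *)
have [q [q0 hq sq]] := exists_syz (fun j m => ((j == i) && (m == l))%:R).
rewrite (bigD1 i) //= (bigD1 l) //= !eqxx mulr1 big1 ?addr0; last first.
  by move=> m /negPf ->; rewrite mulr0.
rewrite big1 ?addr0 => [qil|j /negPf ->]; last by rewrite big1 // => m _; rewrite mulr0.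
exists p, q; split=> //; apply: (syz_basis_of_indep dk k_gt1 hu hE irE uE hF hFu hp hq sp sq).
move=> a b ab0.
have a0 : a = 0.
  have := congr1 (fun v : 'rV_3 => (v 0 i)@_(mnm2 l (k - l))) ab0.
  rewrite !mxE mcoeffD !mcoeffCM qil mulr0 addr0 mcoeff0 => /eqP.
  by rewrite mulf_eq0 (negPf pil) orbF => /eqP.
split=> //; apply/eqP/negPn/negP => b0; case/eqP: q0.
move: ab0; rewrite a0 mpolyC0 scale0r add0r => /rowP bq.
apply/rowP => j; have /eqP := bq j; rewrite !mxE mulf_eq0 mpolyC_eq0 (negPf b0).
by move/eqP.
Qed.

Lemma mcoeff_pencil m : (pencil F)@_m =
  'X_0 * ((F 1)@_m)%:MP - 'X_1 * ((F 0)@_m)%:MP.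
Proof.
have e (l l' : 'I_2) : (Tvar K l * ofX (F l'))@_m = 'X_l * ((F l')@_m)%:MP.
  by apply: etrans (mcoeffCM _ _ _) _; congr (_ * _); apply: mcoeff_map_mpoly.
exact: etrans (mcoeffB _ _ _) (congr2 (fun x y => x - y) (e 0 1) (e 1 0)).
Qed.

Definition quadratic_mnm : seq 'X_{1..3} :=
  [seq s2m (val t) | t <- enum (basis 3 2)].

Lemma exists_Q : exists Q, [/\ bihomog (k - 1) 2 Q, Q \in rees_ideal u, Q != 0 &
  exists2 c : K, c != 0 & evalT F Q = c *: E].
Proof.
have [hu2 _] := hu; have [hF2 _] := hF.
have E0 : E != 0 by case: irE.
have kS : k = (k - 1).+1 by lia.
set k1 := (k - 1)%N in kS *.
pose sb := quadratic_mnm.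
have szb : size sb = 6%N by rewrite [LHS](size_basis 2 2).
have unb : uniq sb by apply: (uniq_basis 3 2).
pose mon (i : 'I_6) := nth 0%MM sb i.
have inb (i : 'I_6) : mon i \in sb by rewrite mem_nth ?szb.
have degb (i : 'I_6) : mdeg (mon i) = 2%N by apply/eqP; rewrite (basis_cover 2).
have monI (i j : 'I_6) : (mon i == mon j) = (i == j) by rewrite nth_uniq ?szb.
(* A monomial that occurs in [F 1]; the coefficient of Q at this monomial serves to exclude
   multiples of the pencil. *)
have [i0 F1i] : exists i0, (F 1)@_(mon i0) != 0.
  have [F10 _] := F_neq0_coprime hF.
  have := mlead_supp F10; set m := mlead _ => mF.
  have : m \in sb by rewrite -(basis_cover 2); apply/eqP; have /dhomogP := hF2 1; apply.
  move=> /(nthP 0%MM)[i]; rewrite szb => lt6 em.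
  by exists (Ordinal lt6); rewrite /mon /= em -mcoeff_msupp.
pose I := ('I_6 * 'I_k1.+1)%type; pose n := (k1 + d * 2)%N.
pose v (i : I) : {mpoly K[2]} :=
  'X_[mnm2 i.2 (k1 - i.2)] * mmap1 u (mon i.1).
have hv i : v i \is n.-homog.
  apply: dhomogM; first exact: mnm2_homog.
  have /(subst_homog hu2) : ('X_[mon i.1] : {mpoly K[3]}) \is 2.-homog.
    by rewrite dhomogX; apply/eqP; apply: degb.
  by rewrite substE mmapX.
(* The 5k conditions [inl r] place Q in the Rees ideal. The k - 1 conditions [inr l] leave only the
   term in ['X_1 ^+ k1] of the coefficient at [mon i0]. Together they are fewer than the 6k
   unknowns. *)
pose w (i : I) (j : 'I_n.+1 + 'I_k1) : K :=
  match j with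
  | inl r => (v i)@_(mnm2 r (n - r))
  | inr l => ((i.1 == i0) && (i.2 == lift ord0 l))%:R
  end.
have [|x [[i xi] ex]] := @linear_system K _ _ w.
  by rewrite card_sum card_prod !card_ord /n dk; lia.
pose a (i : 'I_6) : {mpoly K[2]} := \sum_(l < k1.+1) x (i, l) *: 'X_[mnm2 l (k1 - l)].
have ax j (l : 'I_k1.+1) : (a j)@_(mnm2 l (k1 - l)) = x (j, l).
  exact: (mcoeff_mnm2_sum (fun l => x (j, l))).
pose Q : {mpolyTX K} := \sum_(i < 6) a i *: 'X_[mon i].
have ha j : a j \is k1.-homog.
  by rewrite rpred_sum // => l _; rewrite rpredZ // mnm2_homog.
have Qa j : Q@_(mon j) = a j.
  rewrite /Q raddf_sum (bigD1 j) //= big1 ?addr0 => [|i' ij].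
    by rewrite mcoeffZ mcoeffX eqxx mulr1.
  by rewrite mcoeffZ mcoeffX monI (negPf ij) mulr0.
have hQ : bihomog k1 2 Q.
  split=> [|m].
    by rewrite rpred_sum // => j _; rewrite rpredZ // dhomogX; apply/eqP; apply: degb.
  rewrite /Q raddf_sum rpred_sum // => j _ /=.
  by rewrite mcoeffZ mcoeffX; case: eqP => _; rewrite ?mulr1 ?mulr0 ?rpred0 //; apply: ha.
have Q0 : Q != 0.
  apply: contraNneq xi => eQ; case: i => j l.
  by rewrite -ax -Qa eQ !mcoeff0.
have rQ : Q \in rees_ideal u.
  have sum0 : \sum_j a j * mmap1 u (mon j) = 0.
    apply: (binary_form_eq0 (n := n)) => [|r].
      apply: rpred_sum => j _; rewrite mulr_suml; apply: rpred_sum => l _.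
      by rewrite -scalerAl rpredZ //; apply: (hv (j, l)).
    rewrite -[RHS](ex (inl r)) raddf_sum /=.
    transitivity (\sum_i \sum_l x (i, l) * w (i, l) (inl r)); last first.
      by rewrite pair_bigA; apply: eq_bigr => -[].
    apply: eq_bigr => j _; rewrite mulr_suml raddf_sum.
    by apply: eq_bigr => l _; rewrite /= -scalerAl mcoeffZ.
  apply/eqP; rewrite /Q (rmorph_sum (rees_map u)) /=.
  transitivity ((\sum_j a j * mmap1 u (mon j)) *: 'X^2); last by rewrite sum0 scale0r.
  rewrite scaler_suml; apply: eq_bigr => j _.
  rewrite /rees_map mmapZ mmapX mul_polyC -scalerA; congr (_ *: _).
  rewrite -[X in 'X^X](degb j) /mmap1 mdegE.
  under [LHS]eq_bigr => l _ do rewrite /= -mul_polyC exprMn.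
  rewrite big_split /= prodrXr -mul_polyC rmorph_prod; congr (_ * _).
  by apply: eq_bigr => l _; rewrite rmorphXn.
exists Q; split=> //.
have [_ hT] := hQ.
(* The degree of [evalT F Q] is 2(k - 1) + 2 = d, so the cofactor of [E] is constant. *)
have [c ec] : exists c, evalT F Q = c *: E.
  apply: (dvds_homog_eq E0 hE).
    have := evalT_homog hF2 hQ; rewrite (_ : (2 * k1 + 2)%N = d) //.
    by rewrite dk kS; lia.
  exact: (rees_dvds dk k_gt1 hu irE uE hF hFu hT rQ).
(* If [c] were zero, Q would be the pencil times an element of X-degree 0, that is, a polynomial in
   T alone. *)
exists c => //; apply/negP => /eqP c0; rewrite c0 scale0r in ec.
have [M eM] := evalT_eq0 hF hT ec.
have := pencil_mul_bihomog hF hQ eM; case: ifP => _ eQ; last by rewrite eQ eqxx in Q0.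
set B := bicomp _ _ _ in eQ.
have [hB _] : bihomog (k1 - 1) (2 - 2) B by apply: bicomp_bihomog.
have eB : B = (B@_0)%:MP.
  apply/mpolyP => m; rewrite mcoeffC; case: eqP => [->|/eqP m0]; first by rewrite mulr1.
  by rewrite mulr0; apply: (dhomog_nemf_coeff hB); rewrite mdeg_eq0.
set s := B@_0 in eB.
have s0 : s != 0.
  by apply: contraNneq Q0 => s0; rewrite eQ eB s0 mpolyC0 mul0r.
pose y (l : 'I_2) := (F l)@_(mon i0).
have eQi : a i0 = s * ('X_0 * (y 1)%:MP - 'X_1 * (y 0)%:MP).
  by rewrite -Qa eQ eB mcoeffCM mcoeff_pencil.
have eai : a i0 = x (i0, ord0) *: 'X_1 ^+ k1.
  rewrite /a big_ord_recl big1 ?addr0 => [|l _].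
    by rewrite subn0 mpolyX2 expr0 mul1r.
  have := ex (inr l).
  rewrite (bigD1 (i0, lift ord0 l)) //= !eqxx mulr1 big1 ?addr0.
    by move=> ->; rewrite scale0r.
  case=> j m; rewrite xpair_eqE negb_and /= => /orP[] /negPf ->.
    by rewrite mulr0.
  by rewrite andbF mulr0.
(* At the point [y] the pencil's coefficient at [mon i0] vanishes, whereas ['X_1] takes the nonzero
   value [y 1]. *)
have x0 : x (i0, ord0) = 0.
  have := congr1 (meval y) eQi; rewrite eai mevalZ rmorphXn /= mevalXU.
  rewrite mevalM mevalB !mevalM !mevalXU !mevalC [y 0 * _]mulrC subrr mulr0 => /eqP.
  by rewrite mulf_eq0 expf_eq0 (negPf F1i) andbF orbF => /eqP.
move: eQi; rewrite eai x0 scale0r => /esym/eqP; rewrite mulf_eq0 (negPf s0) /=.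
have cX (l : 'I_2) e : ('X_l * e%:MP : {mpoly K[2]})@_U_(0) = e * (l == 0)%:R.
  by rewrite mulrC mcoeffCM mcoeffXU.
(* The remaining linear form has the nonzero coefficient [y 1] at ['X_0]. *)
move/eqP/(congr1 (mcoeff U_(0))); rewrite mcoeffB mcoeff0 !cX.
by rewrite mulr1 mulr0 subr0 => /eqP; rewrite (negPf F1i).
Qed.

End Existence.

(** * Generation *)

Section Span.
Variable R : comNzRingType.
Implicit Types (s : seq R) (x y : R).

(** Coefficients are indexed by all naturals, so that they do not depend on the length of [s]. *)
Definition in_span s x : Prop := exists c : nat -> R, x = \sum_(i < size s) c i * s`_i.

Lemma in_spanP s x :
  in_span s x <-> exists c : 'I_(size s) -> R, x = \sum_(i < size s) c i * s`_i.
Proof.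
split=> [[c ->]|[c ->]]; first by exists (fun i => c i).
exists (fun i => if insub i is Some j then c j else 0).
by apply: eq_bigr => i _; rewrite valK.
Qed.

Lemma in_spanD s x y : in_span s x -> in_span s y -> in_span s (x + y).
Proof.
move=> [c ->] [e ->]; exists (fun i => c i + e i).
by rewrite -big_split; apply: eq_bigr => i _; rewrite mulrDl.
Qed.

Lemma in_spanM s x y : in_span s y -> in_span s (x * y).
Proof.
move=> [c ->]; exists (fun i => x * c i).
by rewrite mulr_sumr; apply: eq_bigr => i _; rewrite mulrA.
Qed.

Lemma in_span_mem s x : x \in s -> in_span s x.
Proof.
move=> xs; exists (fun i => (i == index x s)%:R).
have lt : (index x s < size s)%N by rewrite index_mem.
rewrite (bigD1 (Ordinal lt)) //= eqxx mul1r nth_index // big1 ?addr0 // => i ni.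
by rewrite -val_eqE /= in ni; rewrite (negPf ni) mul0r.
Qed.

(** A combination of a subsequence is one of the whole sequence, with coefficient zero at the
    omitted positions. *)
Lemma in_span_mask s (m : bitseq) x : in_span (mask m s) x ->
  exists2 c : nat -> R, x = \sum_(i < size s) c i * s`_i &
    forall i, ~~ nth false m i -> c i = 0.
Proof.
elim: s m x => [|y s IH] m x.
  rewrite mask0 => -[c ->]; exists (fun=> 0) => //=; by rewrite !big_ord0.
case: m => [|b m] /=.
  move=> -[c ->]; exists (fun=> 0) => //=; rewrite big_ord0 big1 // => i _.
  by rewrite mul0r.
case: b => [|] /=.
  case=> c; rewrite big_ord_recl /= => ex.
  have [|e ee e0] := IH m (\sum_(i < size (mask m s)) c i.+1 * (mask m s)`_i).
    by exists (fun i => c i.+1).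
  exists (fun i => if i is j.+1 then e j else c 0%N).
    by rewrite ex ee big_ord_recl.
  by case=> [|i] //=; apply: e0.
case/IH => e -> e0; exists (fun i => if i is j.+1 then e j else 0).
  by rewrite big_ord_recl /= mul0r add0r.
by case=> [|i] //=; apply: e0.
Qed.

(** A proper generating subsequence omits some position, and the entry there would be a combination
    of the other entries. *)
Lemma minimal_generators_of_indep s (I : {pred R}) : generates s I ->
  (forall i, (i < size s)%N -> forall c : nat -> R, c i = 0 ->
    s`_i = \sum_(j < size s) c j * s`_j -> False) ->
  minimal_generators s I.
Proof.
move=> gen ind; split=> // s' /subseqP[m sm es'] gen'.
have [/all_pred1P am|nall] := boolP (all (pred1 true) m).
  by rewrite es' am sm mask_true.
have [i lti mi] : exists2 i, (i < size s)%N & ~~ nth false m i.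
  move: nall; rewrite -has_predC => /(has_nthP false)[i]; rewrite sm => lti /=.
  by rewrite eqb_id; exists i.
have : s`_i \in I by apply/gen/in_spanP/in_span_mem; rewrite mem_nth.
move/gen'/in_spanP; rewrite es' => /in_span_mask[c ec /(_ i mi) ci].
by case: (ind i lti c ci ec).
Qed.

End Span.

(** * The ideal of a point of the projective plane *)

Section PointIdeal.
Variable K : fieldType.

Definition linear_form n (v : 'rV[K]_n) : {mpoly K[n]} := \sum_i v 0 i *: 'X_i.

Lemma linear_formD n (v w : 'rV[K]_n) : linear_form (v + w) = linear_form v + linear_form w.
Proof. by rewrite -big_split; apply: eq_bigr => i _; rewrite mxE scalerDl. Qed.

Lemma linear_formZ n a (v : 'rV[K]_n) : linear_form (a *: v) = a *: linear_form v.
Proof. by rewrite scaler_sumr; apply: eq_bigr => i _; rewrite mxE scalerA. Qed.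

Lemma linear_form_delta n (i : 'I_n) : linear_form (delta_mx 0 i) = 'X_i.
Proof.
rewrite /linear_form (bigD1 i) //= mxE !eqxx scale1r big1 ?addr0 // => j ji.
by rewrite mxE (negPf ji) andbF scale0r.
Qed.

(** The predicate [I] stands for an ideal: modulo it each variable is congruent to [y i], hence
    every polynomial to its substitution. *)
Lemma mmap_congr n (I : {mpoly K[n]} -> Prop) (y : 'I_n -> {mpoly K[n]}) g :
  I 0 -> (forall a b, I a -> I b -> I (a + b)) -> (forall a b, I b -> I (a * b)) ->
  (forall i, I ('X_i - y i)) -> I (g - mmap (@mpolyC n K) y g).
Proof.
move=> I0 ID IM IX.
have IMM a b a' b' : I (a - a') -> I (b - b') -> I (a * b - a' * b').
  move=> ia ib; have -> : a * b - a' * b' = b * (a - a') + a' * (b - b') by ring.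
  by apply: ID; apply: IM.
rewrite {1}[g]mpolyE /mmap -sumrB; apply: big_ind => // m _.
rewrite -mul_mpolyC -mulrBr; apply: IM; rewrite mpolyXE_id.
apply: (big_ind2 (fun a b => I (a - b))) => [|a a' b b'|i _].
- by rewrite subrr.
- exact: IMM.
- elim: (m i) => [|l IH]; first by rewrite !expr0 subrr.
  by rewrite !exprS; apply: IMM.
Qed.

(** With [w 0 c] nonzero, each X_i - (w_i / w_c) X_c is a linear form vanishing at [w], hence a
    combination of [p] and [q]. Modulo these forms, [g] is congruent to a polynomial in X_c alone,
    which is zero. *)
Lemma point_ideal (w p q : 'rV[K]_3) (g : {mpoly K[3]}) : w != 0 ->
  lin_indep p q -> p *m w^T = 0 -> q *m w^T = 0 ->
  mmap (@polyC K) (fun i => w 0 i *: 'X) g = 0 ->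
  exists a b, g = a * linear_form p + b * linear_form q.
Proof.
move=> w0 ind pw qw gw.
have [c wc] : exists c, w 0 c != 0.
  apply: NNPP => nex; case/eqP: w0; apply/rowP => i; rewrite mxE.
  by apply/eqP/negPn/negP => wi; apply: nex; exists i.
(* Replacing each X_i by w_i [z] specializes the vanishing of [g] along the line through [w], so the
   result is zero. *)
pose z : {mpoly K[3]} := (w 0 c)^-1 *: 'X_c.
pose y i : {mpoly K[3]} := w 0 i *: z.
have yg : mmap (@mpolyC 3 K) y g = 0.
  have -> : mmap (@mpolyC 3 K) y g =
      (map_poly (@mpolyC 3 K) (mmap (@polyC K) (fun i => w 0 i *: 'X) g)).[z].
    apply: (mpoly_morph_ext (f := mmap (@mpolyC 3 K) y)
      (g := horner_eval z \o map_poly (@mpolyC 3 K) \o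
            mmap (@polyC K) (fun i => w 0 i *: 'X)) _ _ g) => [e|i] /=.
      by rewrite !mmapC map_polyC /horner_eval hornerC.
    rewrite !mmapX !mmap1U map_polyZ map_polyX /horner_eval hornerZ hornerX.
    by rewrite mul_mpolyC.
  by rewrite gw rmorph0 horner0.
pose I (h : {mpoly K[3]}) := exists a b, h = a * linear_form p + b * linear_form q.
suff : I (g - mmap (@mpolyC 3 K) y g) by rewrite yg subr0.
apply: mmap_congr.
- by exists 0, 0; rewrite !mul0r addr0.
- by move=> _ _ [a [b ->]] [a' [b' ->]]; exists (a + a'), (b + b'); ring.
- by move=> h _ [a [b ->]]; exists (h * a), (h * b); ring.
- move=> i; pose l : 'rV[K]_3 := delta_mx 0 i + (- (w 0 i / w 0 c)) *: delta_mx 0 c.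
  have lw : l *m w^T = 0.
    rewrite mulmxDl -scalemxAl -!rowE; apply/rowP => j; rewrite !mxE.
    by rewrite ord1 mulNr divfK // subrr.
  have [a [b el]] := orthogonal_span w0 ind pw qw lw.
  exists a%:MP, b%:MP; rewrite !mul_mpolyC -!linear_formZ -linear_formD -el.
  rewrite linear_formD linear_formZ !linear_form_delta scaleNr.
  by rewrite /y /z scalerA.
Qed.

End PointIdeal.

(* Stated over semirings, with the ring properties needed as hypotheses: unifying
   ring structures on polynomials over polynomials is prohibitively slow. *)
Lemma rmorph_sub_cross (A B : pzSemiRingType) (f : {rmorphism A -> B})
    (t0 t1 x0 x1 w : A) : (forall y z : B, y + z = z -> y = 0) ->
  f t0 * f x1 = f t1 * f x0 -> w + t1 * x0 = t0 * x1 -> f w = 0.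
Proof.
move=> canc e ew; apply: (canc _ (f (t1 * x0))).
by rewrite -rmorphD ew !rmorphM.
Qed.

Lemma comb_cancelr (A : pzRingType) (P x b b' t : A) :
  (forall c, c * t = 0 -> c = 0) -> P = x + b * t -> P = x + b' * t -> b' = 0 ->
  b = 0.
Proof. by move=> reg -> e b0; apply: reg; move/addrI: e ->; rewrite b0 mul0r. Qed.

Lemma comb_cancell (A : pzRingType) (P x b b' t : A) :
  (forall c, c * t = 0 -> c = 0) -> P = b * t + x -> P = b' * t + x -> b' = 0 ->
  b = 0.
Proof. by move=> reg -> e b0; apply: reg; move/addIr: e ->; rewrite b0 mul0r. Qed.

Lemma comb0 (A : pzSemiRingType) (x y : A) : 0 * x + 0 * y = 0.
Proof. by rewrite !mul0r addr0. Qed.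

Lemma rmorph_exchange (A B : pzSemiRingType) (f : {rmorphism A -> B})
    (t0 t1 x0 x1 a b : A) : f t0 = f x0 -> f t1 = f x1 ->
  f (a * t0 + b * t1) = f (a * x0 + b * x1).
Proof. by move=> e0 e1; rewrite !rmorphD !rmorphM e0 e1. Qed.

(** In the image, t0 (a x0 + b x1) = x0 (a t0 + b t1) by the cross relation, and t0 cancels. *)
Lemma rmorph_chain (A B : pzSemiRingType) (f : {rmorphism A -> B})
    (t0 t1 x0 x1 a b : A) : commutative (@GRing.mul B) ->
  (forall y, f t0 * y = 0 -> y = 0) -> f t0 * f x1 = f t1 * f x0 ->
  f (a * t0 + b * t1) = 0 -> f (a * x0 + b * x1) = 0.
Proof.
move=> comm reg e fP; apply: reg; rewrite -[RHS](mul0r (f x0)) -fP.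
rewrite !rmorphD !rmorphM mulrDr mulrDl !mulrA (comm (f t0)) (comm (f t0)).
by rewrite -[_ * f t0 * f x1]mulrA e mulrA.
Qed.

Lemma rmorph_divide (A B : pzSemiRingType) (f : {rmorphism A -> B})
    (t x p q a b r P : A) : (forall y, f t * y = 0 -> y = 0) ->
  f p = 0 -> f q = 0 -> f P = 0 ->
  P = x * (a * p + b * q) + t * r -> f r = 0.
Proof.
move=> reg fp fq fP eP; apply: reg; rewrite -[RHS]fP eP.
by rewrite rmorphD !rmorphM rmorphD !rmorphM fp fq !mulr0 addr0 mulr0 add0r.
Qed.

(** The equation for [g] says that [P] and the combination of [p] and [q], multiplied by [t0 ^+ e],
    agree modulo [t1]. *)
Lemma reduce_by_syzygies (A : comPzRingType) (t0 t1 g gp gq P p q P1 p1 q1 a b : A) e k :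
  P = g * t0 ^+ (e + k) + t1 * P1 -> p = gp * t0 ^+ k + t1 * p1 ->
  q = gq * t0 ^+ k + t1 * q1 -> g = a * gp + b * gq ->
  P = t0 ^+ e * (a * p + b * q) + t1 * (P1 - t0 ^+ e * (a * p1 + b * q1)).
Proof. by move=> -> -> -> ->; rewrite exprD; ring. Qed.

(** * Elements of the Rees ideal: the pencil and the chain P_i *)

Section Generation.
Variables (K : closedFieldType) (d k : nat) (u : 'I_3 -> {mpoly K[2]})
  (E : {mpoly K[3]}) (F : 'I_2 -> {mpoly K[3]}).
Hypotheses (dk : d = (2 * k)%N) (k_gt1 : (1 < k)%N) (hu : coprime_forms d u)
  (hE : E \is d.-homog) (irE : irred E) (uE : evalZ u E = 0)
  (hF : coprime_forms 2 F) (hFu : defines_inverse u F).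
Implicit Types (P Q : {mpolyTX K}).

Lemma rees_map_Tvar_reg l (y : {poly {mpoly K[2]}}) :
  rees_map u (Tvar K l) * y = 0 -> y = 0.
Proof.
rewrite rees_map_Tvar mul_polyC => /polyP e; apply/polyP => i.
by have /eqP := e i; rewrite coefZ !coef0 mulf_eq0 (negPf (mpolyX_neq0 K l)) => /eqP.
Qed.

Lemma rees_cross : rees_map u (Tvar K 0) * rees_map u (ofX (F 1)) =
  rees_map u (Tvar K 1) * rees_map u (ofX (F 0)).
Proof.
apply: etrans (congr2 *%R (rees_map_Tvar u 0) (rees_map_ofX u (F 1))) _.
apply: etrans _ (esym (congr2 *%R (rees_map_Tvar u 1) (rees_map_ofX u (F 0)))).
by apply: etrans (esym (evalZ_cross hF hFu 1)) _; apply: mulrC.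
Qed.

Lemma rees_pencil : rees_map u (pencil F) = 0.
Proof.
apply: (rmorph_sub_cross (f := rees_map u) _ rees_cross); last exact: subrK.
by move=> y z e; apply: (addIr z); rewrite e add0r.
Qed.

Lemma Tvar_reg l P : P * Tvar K l = 0 -> P = 0.
Proof.
move=> e; have {}e : Tvar K l * P = 0 := etrans (mulrC _ _) e.
apply/mpolyP => m; have {e} := etrans (esym (mcoeffCM 'X_l P m)) (congr1 (mcoeff m) e).
rewrite !mcoeff0 => /eqP; rewrite mulf_eq0 (negPf (mpolyX_neq0 K l)) => /eqP.
by [].
Qed.

(** Compare with the components of bidegree (i, j): a summand of another bidegree has zero component
    there and must itself vanish. For [P = 0] this fails, as [A = T_2], [B = - T_1] shows. *)
Lemma bihomog_quotients i j P A B : P != 0 -> bihomog i.+1 j P ->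
  bihomogeneous A -> bihomogeneous B -> P = A * Tvar K 0 + B * Tvar K 1 ->
  bihomog i j A /\ bihomog i j B.
Proof.
move=> P0 hP [a [a' hA]] [b [b' hB]] eP.
have bz : bihomog i j (0 : {mpolyTX K}).
  by rewrite -(raddf0 (bicomp i j)); apply: bicomp_bihomog.
have ePc : P = bicomp i j A * Tvar K 0 + bicomp i j B * Tvar K 1.
  rewrite -[LHS](bicomp_id hP) eP; apply: etrans (raddfD (bicomp i.+1 j) _ _) _.
  have bm C l : bicomp i.+1 j (C * Tvar K l) = bicomp i j C * Tvar K l.
    by rewrite (bicomp_mulr _ _ _ (bihomog_Tvar K l)) /= subSS !subn0.
  by congr (_ + _); apply: bm.
have [ea|na] := eqVneq (a, a') (i, j); have [eb|nb] := eqVneq (b, b') (i, j).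
- by case: ea hA eb hB => -> -> hA [-> ->].
- have B0 : bicomp i j B = 0 by apply: bicomp_ne0 hB nb.
  case: ea hA => -> -> hA; split=> //; rewrite (_ : B = 0) //.
  rewrite (bicomp_id hA) in ePc.
  exact: (comb_cancelr (@Tvar_reg 1) eP ePc B0).
- have A0 : bicomp i j A = 0 by apply: bicomp_ne0 hA na.
  case: eb hB => -> -> hB; split=> //; rewrite (_ : A = 0) //.
  rewrite (bicomp_id hB) in ePc.
  exact: (comb_cancell (@Tvar_reg 0) eP ePc A0).
- case/eqP: P0; rewrite ePc (bicomp_ne0 hA na) (bicomp_ne0 hB nb).
  exact: comb0.
Qed.

Section Chain.
Variables (c : K) (P A B : nat -> {mpolyTX K}).
Hypotheses (c0 : c != 0) (hQ : bihomog (k - 1) 2 (P (k - 1)%N))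
  (rQ : P (k - 1)%N \in rees_ideal u) (eQ : evalT F (P (k - 1)%N) = c *: E)
  (hAB : forall j : nat, (j <= k - 2)%N ->
           [/\ bihomogeneous (A (k - j)%N), bihomogeneous (B (k - j)%N),
               P (k - 1 - j)%N
                 = A (k - j)%N * Tvar K 0 + B (k - j)%N * Tvar K 1 &
               P (k - j - 2)%N
                 = A (k - j)%N * ofX (F 0) + B (k - j)%N * ofX (F 1)]).

(** Each step lowers the T-degree by 1 and raises the X-degree by 2. It preserves the value under
    [evalT F], since T_l and F_l have the same image, and membership in the Rees ideal by
    [rmorph_chain]. *)
Lemma chain_spec i : (i < k)%N ->
  [/\ bihomog i (d - 2 * i) (P i), P i \in rees_ideal u & evalT F (P i) = c *: E].
Proof.
have [hF2 _] := hF; have E0 : E != 0 by case: irE.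
suff st j : (j < k)%N -> [/\ bihomog (k - 1 - j) (d - 2 * (k - 1 - j)) (P (k - 1 - j)%N),
    P (k - 1 - j)%N \in rees_ideal u & evalT F (P (k - 1 - j)%N) = c *: E].
  move=> ik; have := st (k - 1 - i)%N; rewrite (_ : k - 1 - (k - 1 - i) = i)%N; last lia.
  by apply; lia.
elim: j => [|j IH] jk.
  by rewrite subn0 (_ : d - 2 * (k - 1) = 2)%N //; rewrite dk; lia.
have [hP rP eP] := IH (ltnW jk).
have [|hA hB eAB] := hAB (j := j); first lia.
rewrite (_ : k - j - 2 = k - 1 - j.+1)%N => [eP'|]; last lia.
have eTX l : evalT F (Tvar K l) = evalT F (ofX (F l)) by rewrite evalT_Tvar evalT_ofX.
have ePE : evalT F (P (k - 1 - j.+1)%N) = c *: E.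
  rewrite -eP eAB eP'; symmetry; exact: (rmorph_exchange _ _ (eTX 0) (eTX 1)).
(* The quotients are known to have the expected bidegree because the dividend is nonzero, which its
   image under [evalT F] shows. *)
have P0 : P (k - 1 - j)%N != 0.
  apply/negP => /eqP P0; move: eP; rewrite P0 (rmorph0 (evalT F)) => /esym/eqP.
  by rewrite -mul_mpolyC mulf_eq0 mpolyC_eq0 (negPf c0) (negPf E0).
split; last exact: ePE.
- rewrite (_ : k - 1 - j = (k - 1 - j.+1).+1)%N in hP; last lia.
  rewrite (_ : k - 1 - j = (k - 1 - j.+1).+1)%N in P0 eAB; last lia.
  have [hA' hB'] := bihomog_quotients P0 hP hA hB eAB.
  rewrite eP'; set n := (k - 1 - j.+1)%N in hA' hB' *.
  rewrite (_ : d - 2 * n = d - 2 * n.+1 + 2)%N; last by rewrite dk /n; lia.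
  rewrite -[X in bihomog X]addn0; apply: bihomogD.
    exact: (bihomogM hA' (bihomog_ofX (hF2 0))).
  exact: (bihomogM hB' (bihomog_ofX (hF2 1))).
- apply/eqP; rewrite eP'; move/eqP: rP; rewrite eAB => rP.
  by apply: (rmorph_chain (f := rees_map u) _ (@rees_map_Tvar_reg 0) rees_cross rP);
     apply: mulrC.
Qed.

End Chain.

Lemma rees_map_coef n j P : (msize P <= n)%N ->
  (rees_map u P)`_j =
    \sum_(m : 'X_{1..3 < n}) (P@_m * mmap1 u m) *+ (mdeg m == j).
Proof.
move=> hn; rewrite /rees_map (mmapE _ hn) coef_sum; apply: eq_bigr => m _.
have -> : mmap1 (fun i => u i *: 'X) m = mmap1 u m *: 'X^(mdeg m).
  rewrite [X in 'X^X]mdegE /mmap1.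
  under [LHS]eq_bigr => l _ do rewrite /= -mul_polyC exprMn.
  rewrite big_split /= prodrXr -mul_polyC rmorph_prod; congr (_ * _).
  by apply: eq_bigr => l _; rewrite rmorphXn.
by rewrite coefCM coefZ coefXn eq_sym mulrA; case: eqP; rewrite ?mulr1 ?mulr0.
Qed.

(** All [u i] have degree [d], so the T-component of degree i contributes to the coefficient of Z^j
    exactly in degree i + dj; distinct components cannot cancel. *)
Lemma Tcomp_rees i P : P \in rees_ideal u -> Tcomp i P \in rees_ideal u.
Proof.
have [hu2 _] := hu.
move=> /eqP rP; apply/eqP/polyP => j; rewrite coef0.
have [n [hn hn']] : exists n, (msize P <= n)%N /\ (msize (Tcomp i P) <= n)%N.
  by exists (maxn (msize P) (msize (Tcomp i P))); rewrite leq_maxl leq_maxr.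
have := rees_map_coef j hn; rewrite rP coef0 => /(congr1 (pihomog mdeg (i + d * j))).
rewrite raddf0 raddf_sum /= (rees_map_coef _ hn') => e; rewrite [RHS]e.
apply: eq_bigr => m _; rewrite mcoeff_Tcomp.
case: eqP => [<-|]; last by rewrite !mulr0n raddf0.
have hm : mmap1 u m \is (d * mdeg m).-homog.
  have /(subst_homog hu2) : ('X_[m] : {mpoly K[3]}) \is (mdeg m).-homog.
    by rewrite dhomogX.
  by rewrite substE mmapX.
by rewrite !mulr1n (pihomog_mulr _ _ hm) leq_addl addnK.
Qed.

Lemma Tcomp_partition P : exists n, P = \sum_(i < n) Tcomp i P.
Proof.
exists (\max_(m <- msupp P) msize P@_m); apply/mpolyP => m.
rewrite raddf_sum /=; under eq_bigr => i _ do rewrite mcoeff_Tcomp.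
have [mP|/memN_msupp_eq0 ->] := boolP (m \in msupp P).
  by apply: pihomog_partitionE; rewrite (bigD1_seq m) //= leq_maxl.
by rewrite big1 // => i _; rewrite raddf0.
Qed.

(** * Generation of the Rees ideal *)

Section Generate.
Variables (p q : 'rV[{mpoly K[2]}]_3) (c : K) (P : nat -> {mpolyTX K})
  (s : seq {mpolyTX K}).
Hypotheses (bpq : syz_basis u p q) (hp : homog_syz k p) (hq : homog_syz k q)
  (c0 : c != 0)
  (hP : forall i, (i < k)%N -> [/\ Thomog i (P i), P i \in rees_ideal u &
    evalT F (P i) = c *: E])
  (sD : pencil F \in s) (sP : forall i, (i < k)%N -> P i \in s)
  (s_p : syz_form p \in s) (s_q : syz_form q \in s).

Let syz_p : syzygy u p.
Proof.
by case: bpq => /(_ p)[_ h] _; apply: h; exists 1, 0; rewrite scale1r scale0r addr0.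
Qed.

Let syz_q : syzygy u q.
Proof.
by case: bpq => /(_ q)[_ h] _; apply: h; exists 0, 1; rewrite scale1r scale0r add0r.
Qed.

Let ind : lin_indep (ev10 p) (ev10 q).
Proof.
apply: (ev10_indep dk k_gt1 hu hE irE uE hF hFu hp hq syz_p syz_q).
move=> a b e; have [_ fr] := bpq; have [] := fr _ _ e.
by split; apply/eqP; rewrite -(mpolyC_eq0 2); apply/eqP.
Qed.

Lemma at10_syz_form (a : 'rV[{mpoly K[2]}]_3) : at10 (syz_form a) = linear_form (ev10 a).
Proof.
rewrite /at10 /syz_form (rmorph_sum (map_mpoly (meval (@pt10 K)))).
apply: eq_bigr => i _; rewrite /= mxE.
by rewrite map_mpolyZ map_mpolyX.
Qed.

(** Specialization at T = (1, 0) of the relation G(T, u(T) Z) = 0. *)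
Lemma rees_at10 (G : {mpolyTX K}) : G \in rees_ideal u ->
  mmap (@polyC K) (fun i => (\row_i (u i).@[@pt10 K]) 0 i *: 'X) (at10 G) = 0.
Proof.
move=> /eqP rG.
have <- : map_poly (meval (@pt10 K)) (rees_map u G) = 0 by rewrite rG rmorph0.
symmetry.
apply: (mpoly_morph_ext (f := map_poly (meval (@pt10 K)) \o rees_map u)
  (g := mmap (@polyC K) (fun i => (\row_i (u i).@[@pt10 K]) 0 i *: 'X) \o
        @at10 K) _ _ G) => [e|i] /=.
  by rewrite /at10 map_mpolyC mmapC /rees_map mmapC map_polyC.
rewrite /at10 map_mpolyX mmapX /rees_map mmapX !mmap1U mxE.
by rewrite map_polyZ map_polyX.
Qed.

(** With [evalT F G = E * H], subtracting H / c times [P i] leaves an element killed by [evalT F],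
    hence a multiple of the pencil. *)
Lemma low_in_span i (G : {mpolyTX K}) : Thomog i G -> G \in rees_ideal u ->
  (i < k)%N -> in_span s G.
Proof.
move=> hG rG ik; have [hPi _ ePi] := hP ik.
have [H eH] := rees_dvds dk k_gt1 hu irE uE hF hFu hG rG.
set C := ofX (c^-1 *: H).
have hC : Thomog i (C * P i) by exact: (ThomogM (Thomog_ofX _) hPi).
have eC : evalT F (C * P i) = evalT F G.
  rewrite evalTM evalT_ofX ePi eH -scalerAl -scalerAr scalerA mulVf // scale1r.
  exact: mulrC.
have [M eM] := evalT_eq0 hF (ThomogD hG (ThomogN hC)) (etrans (evalTB _ _ _)
  (etrans (congr2 (fun x y => x - y) (esym eC) erefl) (subrr _))).
have -> : G = M * pencil F + C * P i.
  by rewrite -[LHS](subrK (C * P i)) eM; congr (_ + _); apply: mulrC.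
by apply: in_spanD; apply: in_spanM; apply: in_span_mem => //; apply: sP.
Qed.

Lemma Thomog_in_span i (G : {mpolyTX K}) : Thomog i G -> G \in rees_ideal u ->
  in_span s G.
Proof.
elim: i G => [|i IH] G hG rG; first exact: (low_in_span hG rG (ltnW k_gt1)).
have [ik|ki] := ltnP i.+1 k; first exact: low_in_span hG rG ik.
have kS : k = k.-1.+1 by lia.
have hp' : Thomog k (syz_form p) by case: (syz_form_bihomog hp).
have hq' : Thomog k (syz_form q) by case: (syz_form_bihomog hq).
have [G1 hG1 eG] := Thomog_decomp hG.
rewrite kS in hp' hq'.
have [p1 hp1 ep] := Thomog_decomp hp'; have [q1 hq1 eq] := Thomog_decomp hq'.
rewrite -kS in ep eq.
(* The specialization of [G] at T = (1, 0) lies in the ideal of the point u(1, 0), generated by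
   those of the two syzygies. *)
have [a [b eab]] := point_ideal (ev10_u_neq0 dk k_gt1 hu) ind (ev10_orth syz_p)
  (ev10_orth syz_q) (rees_at10 rG).
rewrite -!at10_syz_form in eab.
have eofX : ofX (at10 G) = ofX a * ofX (at10 (syz_form p)) + ofX b * ofX (at10 (syz_form q)).
  rewrite eab; apply: etrans (rmorphD (@ofX K) _ _) _.
  by congr (_ + _); apply: (rmorphM (@ofX K)).
have ei : i.+1 = (i.+1 - k + k)%N by rewrite subnK.
rewrite ei in eG.
(* After subtraction of a combination of the syzygies, what remains is T_2 times an element of
   T-degree [i], to which induction applies. *)
have eG' := reduce_by_syzygies eG ep eq eofX.
set G2 := _ - _ in eG'.
have rp : rees_map u (syz_form p) = 0 by apply/eqP/(syz_form_rees u p).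
have rq : rees_map u (syz_form q) = 0 by apply/eqP/(syz_form_rees u q).
have rG2 : rees_map u G2 = 0.
  exact: (rmorph_divide (@rees_map_Tvar_reg 1) rp rq (eqP rG) eG').
have hG2 : Thomog i G2.
  have h (a' : {mpoly K[3]}) (p' : {mpolyTX K}) : Thomog k.-1 p' -> Thomog k.-1 (ofX a' * p').
    exact: (ThomogM (Thomog_ofX a')).
  have := ThomogM (Thomog_expT K 0 (i.+1 - k)) (ThomogD (h a _ hp1) (h b _ hq1)).
  rewrite (_ : i.+1 - k + k.-1 = i)%N; last lia.
  by move/ThomogN; apply: ThomogD.
have rG2' : G2 \in rees_ideal u by apply/eqP.
clearbody G2; rewrite eG'; apply: in_spanD; last exact: (in_spanM _ (IH G2 hG2 rG2')).
by apply: in_spanM; apply: in_spanD; apply: in_spanM; apply: in_span_mem.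
Qed.

Lemma rees_in_span (G : {mpolyTX K}) : G \in rees_ideal u -> in_span s G.
Proof.
move=> rG; have [n ->] := Tcomp_partition G.
apply: (big_ind (in_span s)) => [|x y|i _].
- by exists (fun=> 0); rewrite big1 // => i _; apply: mul0r.
- exact: in_spanD.
- exact: Thomog_in_span (@Tcomp_Thomog _ i G) (Tcomp_rees i rG).
Qed.

Lemma span_in_rees (G : {mpolyTX K}) : (forall x, x \in s -> x \in rees_ideal u) ->
  in_span s G -> G \in rees_ideal u.
Proof.
move=> sr [e ->]; apply/eqP; apply: etrans (rmorph_sum (rees_map u) _ _ _) _.
apply: big1 => i _; apply: etrans (rmorphM (rees_map u) _ _) _.
by rewrite [X in _ * X](eqP (sr _ (mem_nth 0 (ltn_ord i)))) mulr0.
Qed.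

End Generate.

End Generation.

(** * Minimality *)

Section Minimality.
Variables (K : closedFieldType) (d k : nat) (u : 'I_3 -> {mpoly K[2]})
  (E : {mpoly K[3]}) (F : 'I_2 -> {mpoly K[3]}).
Hypotheses (dk : d = (2 * k)%N) (k_gt1 : (1 < k)%N) (E0 : E != 0)
  (hF : coprime_forms 2 F).
Variables (p q : 'rV[{mpoly K[2]}]_3) (c : K) (P : nat -> {mpolyTX K}).
Hypotheses (bpq : syz_basis u p q) (hp : homog_syz k p) (hq : homog_syz k q)
  (c0 : c != 0)
  (hP : forall i, (i < k)%N -> bihomog i (d - 2 * i) (P i))
  (eP : forall i, (i < k)%N -> evalT F (P i) = c *: E).

Definition gens : seq {mpolyTX K} :=
  pencil F :: [seq P i | i <- iota 0 k] ++ [:: syz_form p; syz_form q].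

Lemma size_gens : size gens = k.+3.
Proof. by rewrite /= size_cat size_map size_iota /= addn2. Qed.

Lemma nth_gens_P i : (i < k)%N -> gens`_i.+1 = P i.
Proof.
move=> ik; rewrite /= nth_cat size_map size_iota ik.
by rewrite (nth_map 0%N) ?size_iota // nth_iota.
Qed.

Lemma nth_gens_p : gens`_k.+1 = syz_form p.
Proof. by rewrite /= nth_cat size_map size_iota ltnn subnn. Qed.

Lemma nth_gens_q : gens`_k.+2 = syz_form q.
Proof. by rewrite /= nth_cat size_map size_iota ltnNge leqnSn subSnn. Qed.

Lemma gens_ind (C : nat -> Prop) : C 0%N -> (forall i, (i < k)%N -> C i.+1) ->
  C k.+1 -> C k.+2 -> forall j, (j < k.+3)%N -> C j.
Proof.
move=> CD CP Cp Cq [|j] //; rewrite ltnS => jk.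
have [/CP//|kj] := ltnP j k.
have /orP[/eqP->|/eqP->] // : (j == k) || (j == k.+1) by lia.
Qed.

(** The shift by one accounts for the pencil at position 0; every position after the chain gets the
    bidegree (k, 1) of the syzygies. *)
Definition gdeg j : nat * nat :=
  if j is i.+1 then if (i < k)%N then (i, d - 2 * i)%N else (k, 1%N) else (1%N, 2%N).

Lemma gens_bihomog j : (j < k.+3)%N -> bihomog (gdeg j).1 (gdeg j).2 gens`_j.
Proof.
apply: (gens_ind (C := fun j => bihomog (gdeg j).1 (gdeg j).2 gens`_j)).
- exact: bihomog_pencil.
- by move=> i ik; rewrite (nth_gens_P ik) /= ik; apply: hP.
- by rewrite nth_gens_p /= ltnn; apply: syz_form_bihomog.
- by rewrite nth_gens_q /= ltnNge leqnSn; apply: syz_form_bihomog.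
Qed.

(** In the component of bidegree [gdeg i], only generators of componentwise smaller or equal
    bidegree contribute. If [j0] is the only candidate, the relation becomes a single multiple. *)
Lemma gens_multiple i j0 (e : nat -> {mpolyTX K}) : (i < k.+3)%N -> (j0 < k.+3)%N ->
  (forall j, (j < k.+3)%N -> j != i ->
     ((gdeg j).1 <= (gdeg i).1)%N -> ((gdeg j).2 <= (gdeg i).2)%N -> j = j0) ->
  e i = 0 -> gens`_i = \sum_(j < size gens) e j * gens`_j ->
  exists2 C, bihomog ((gdeg i).1 - (gdeg j0).1) ((gdeg i).2 - (gdeg j0).2) C &
    gens`_i = C * gens`_j0.
Proof.
move=> ik j0k uniq_j0 ei; rewrite size_gens => es.
(* The value zero covers the case where generator [j0] does not contribute, so truncated differences
   of degrees are harmless. *)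
pose C := if [&& j0 != i, (gdeg j0).1 <= (gdeg i).1 & (gdeg j0).2 <= (gdeg i).2]%N
  then bicomp ((gdeg i).1 - (gdeg j0).1) ((gdeg i).2 - (gdeg j0).2) (e j0) else 0.
have term j : (j < k.+3)%N -> bicomp (gdeg i).1 (gdeg i).2 (e j * gens`_j) =
    if j == j0 then C * gens`_j0 else 0.
  move=> jk; apply: etrans (bicomp_mulr _ _ _ (gens_bihomog jk)) _.
  have [->|nj] := eqVneq j j0.
    rewrite /C; have [->|_] /= := eqVneq j0 i; last by case: ifP => // _; rewrite mul0r.
    by rewrite !leqnn ei raddf0.
  have [ej|ji] := eqVneq j i.
    by rewrite ej ei raddf0 mul0r if_same.
  case: ifP => // /andP[l1 l2].
  by rewrite (uniq_j0 j jk ji l1 l2) eqxx in nj.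
exists C.
  rewrite /C; case: ifP => _; first exact: bicomp_bihomog.
  rewrite -[0](raddf0 (bicomp ((gdeg i).1 - (gdeg j0).1) ((gdeg i).2 - (gdeg j0).2))).
  exact: bicomp_bihomog.
rewrite -[LHS](bicomp_id (gens_bihomog ik)) [in LHS]es.
apply: etrans (raddf_sum (bicomp (gdeg i).1 (gdeg i).2) _ _ _) _.
rewrite (bigD1 (Ordinal j0k)) //= [X in _ + X]big1 ?addr0.
  by rewrite (term _ j0k) eqxx.
move=> j nj; apply: etrans (term _ (ltn_ord j)) _.
by rewrite -val_eqE /= in nj; rewrite (negPf nj).
Qed.

Lemma evalT_bihomog00 (C : {mpolyTX K}) : bihomog 0 0 C -> evalT F C = 0 -> C = 0.
Proof.
case=> _ hT; rewrite (Thomog0_ofX hT) evalT_ofX => ->.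
exact: (rmorph0 (@ofX K)).
Qed.

Lemma bihomog00_scalar (C : {mpolyTX K}) : bihomog 0 0 C -> C = (C@_0)%:MP.
Proof.
case=> hX _; apply/mpolyP => m; rewrite mcoeffC.
case: eqP => [->|/eqP m0]; first by rewrite mulr1.
by rewrite mulr0; apply: (dhomog_nemf_coeff hX); rewrite mdeg_eq0.
Qed.

Lemma pencil_neq0 : pencil F != 0.
Proof.
have [F10 _] := F_neq0_coprime hF; apply: contraNneq F10 => D0.
apply/eqP/mpolyP => m; rewrite mcoeff0.
have := mcoeff_pencil F m; rewrite D0 mcoeff0 => /(congr1 (mcoeff U_(0))).
have cX (l : 'I_2) e : ('X_l * e%:MP : {mpoly K[2]})@_U_(0) = e * (l == 0)%:R.
  by rewrite mulrC mcoeffCM mcoeffXU.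
by rewrite mcoeff0 mcoeffB !cX mulr1 mulr0 subr0.
Qed.

Lemma syz_form_scale (a b : 'rV[{mpoly K[2]}]_3) s : syz_form a = s%:MP * syz_form b ->
  a = s *: b.
Proof.
move=> e; apply/rowP => l; rewrite mxE -mcoeff_syz_form e.
by rewrite mcoeffCM mcoeff_syz_form.
Qed.

Lemma cE_neq0 : c *: E != 0.
Proof. by rewrite -mul_mpolyC mulf_neq0 // mpolyC_eq0. Qed.

Lemma syz_not_multiple (a b : 'rV[{mpoly K[2]}]_3) (C : {mpolyTX K}) :
  bihomog 0 0 C -> syz_form a = C * syz_form b -> exists s, a = s *: b.
Proof.
move=> hC; rewrite (bihomog00_scalar hC) => /syz_form_scale e.
by exists C@_0.
Qed.

Lemma gens_indep i : (i < size gens)%N -> forall e : nat -> {mpolyTX K}, e i = 0 ->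
  gens`_i = \sum_(j < size gens) e j * gens`_j -> False.
Proof.
have k1k : (k - 1 < k)%N by lia.
have nk : (k.+1 < k)%N = false by lia.
have [_ fr] := bpq.
move=> isz; rewrite size_gens in isz; move: i isz; apply: (gens_ind (C := fun i =>
  forall e : nat -> {mpolyTX K}, e i = 0 ->
    gens`_i = \sum_(j < size gens) e j * gens`_j -> False)).
(* By bidegree only P_{k-1} can contribute to the pencil. The truncated bidegree of the cofactor is
   (0, 0), and [evalT F] kills the pencil but not P_{k-1}, so the cofactor is zero. *)
- move=> e ei es; have jk0 : ((k - 1).+1 < k.+3)%N by lia.
  have [|C] := gens_multiple (ltn0Sn _) jk0 _ ei es.
    case=> [|j] //= jk _; case: ifP => jk' /=; lia.
  rewrite (nth_gens_P k1k) /= k1k (_ : 1 - (k - 1) = 0)%N; last lia.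
  rewrite (_ : 2 - (d - 2 * (k - 1)) = 0)%N; last by rewrite dk; lia.
  move=> hC eD; case/eqP: pencil_neq0.
  suff C0 : C = 0 by rewrite eD C0; apply: mul0r.
  apply: evalT_bihomog00 hC _; have := evalT_pencil F.
  rewrite eD evalTM (eP k1k) => /eqP.
  by rewrite mulf_eq0 (negPf cE_neq0) orbF => /eqP.
(* Along the chain a lower T-degree goes with a higher X-degree, so only the pencil can contribute
   to P_i; but [evalT F] kills the pencil and not P_i. *)
- move=> i ik e ei es; have ik3 : (i.+1 < k.+3)%N by lia.
  have [|C hC] := gens_multiple ik3 (ltn0Sn _) _ ei es.
    case=> [|j] //= jk ji; rewrite ik /=.
    by case: ifP => jk' /=; lia.
  rewrite (nth_gens_P ik) /= => ePi; case/eqP: cE_neq0.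
  by rewrite -(eP ik) ePi evalTM evalT_pencil mulr0.
(* Only the other syzygy has X-degree 1, and the cofactor is a scalar, against freeness of the
   basis. *)
- move=> e ei es; have [kp kq] : (k.+1 < k.+3)%N /\ (k.+2 < k.+3)%N by lia.
  have [|C] := gens_multiple kp kq _ ei es.
    case=> [|j] /= jk ji; rewrite ltnn /=; first by lia.
    by case: ifP => jk' /=; lia.
  rewrite nth_gens_p nth_gens_q /= ltnn nk /= !subnn => hC.
  case/(syz_not_multiple hC) => s es'.
  have [] := fr 1 (- s) _; last by move/eqP; rewrite oner_eq0.
  by rewrite es' scale1r scaleNr subrr.
- move=> e ei es; have [kp kq] : (k.+1 < k.+3)%N /\ (k.+2 < k.+3)%N by lia.
  have [|C] := gens_multiple kq kp _ ei es.
    case=> [|j] /= jk ji; rewrite nk /=; first by lia.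
    by case: ifP => jk' /=; lia.
  rewrite nth_gens_p nth_gens_q /= ltnn nk /= !subnn => hC.
  case/(syz_not_multiple hC) => s es'.
  have [] := fr (- s) 1 _; last by move=> _ /eqP; rewrite oner_eq0.
  by rewrite es' scale1r scaleNr addNr.
Qed.

End Minimality.

Theorem theorem5p5 (K : closedFieldType) (d k : nat)
    (u : 'I_3 -> {mpoly K[2]}) (E : {mpoly K[3]}) (F : 'I_2 -> {mpoly K[3]})
    (hdk : d = (2 * k)%N) (hd : (3 < d)%N)
    (hu : coprime_forms d u)
    (hE : E \is d.-homog) (hEirr : irreducible_mpoly E)
    (huE : proper_parameterization E u)
    (hconics : parameterizable_in_degree 2 E)
    (hlines : ~ parameterizable_in_degree 1 E)
    (hF : coprime_forms 2 F) (hFu : defines_inverse u F) :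
  let is_basis p q := [/\ syz_basis u p q, homog_syz k p & homog_syz k q] in
  let is_Q Q := [/\ bihomog (k - 1) 2 Q, Q \in rees_ideal u, Q != 0 &
                    exists2 c : K, c != 0 & evalT F Q = c *: E] in
  [/\ exists p q, is_basis p q,
      exists Q, is_Q Q &
      forall (p q : 'rV[{mpoly K[2]}]_3) (Q : {mpolyTX K})
             (P A B : nat -> {mpolyTX K}),
        is_basis p q -> is_Q Q ->
        P (k - 1)%N = Q ->
        (forall j : nat, (j <= k - 2)%N ->
           [/\ bihomogeneous (A (k - j)%N), bihomogeneous (B (k - j)%N),
               P (k - 1 - j)%N
                 = A (k - j)%N * Tvar K 0 + B (k - j)%N * Tvar K 1 &
               P (k - j - 2)%N
                 = A (k - j)%N * ofX (F 0) + B (k - j)%N * ofX (F 1)]) ->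
        minimal_generators
          (Tvar K 0 * ofX (F 1) - Tvar K 1 * ofX (F 0)
             :: [seq P i | i <- iota 0 k] ++ [:: syz_form p; syz_form q])
          (rees_ideal u)].
Proof.
move=> is_basis is_Q.
have k_gt1 : (1 < k)%N by rewrite hdk in hd; lia.
have irE : irred E := hEirr.
have E0 : E != 0 by case: irE.
(* The parameterization sends every point into the cone of the curve, so E(u) vanishes everywhere
   and is the zero polynomial. *)
have uE : evalZ u E = 0.
  rewrite (evalZ_homog u hE); suff -> : subst u E = 0 by rewrite scale0r.
  apply: mpoly_vanish => x.
  have [g [[_ _ uC] _ _ _]] := huE; have := uC x I.
  rewrite /cone_curve /subst comp_mpoly_meval => eE.
  by rewrite -[RHS]eE; apply: meval_eq => i; rewrite tnth_mktuple.
split.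
- exact: (exists_syz_basis hdk k_gt1 hu hE irE uE hF hFu).
- exact: (exists_Q hdk k_gt1 hu hE irE uE hF hFu).
move=> p q Q P A B [bpq hp hq] [hQ rQ _ [c c0 eQ]] PQ hAB.
rewrite -PQ in hQ rQ eQ.
have spec := chain_spec hdk k_gt1 hE irE hF hFu c0 hQ rQ eQ hAB.
set s := (X in minimal_generators X _).
have sD : pencil F \in s by rewrite inE eqxx.
have sP i : (i < k)%N -> P i \in s.
  by move=> ik; rewrite inE mem_cat map_f ?orbT // mem_iota.
have s_p : syz_form p \in s by rewrite inE mem_cat !inE eqxx !orbT.
have s_q : syz_form q \in s by rewrite inE mem_cat !inE eqxx !orbT.
have [syz_p syz_q] : syzygy u p /\ syzygy u q.
  have [h _] := bpq; split; apply/h.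
    by exists 1, 0; rewrite scale1r scale0r addr0.
  by exists 0, 1; rewrite scale1r scale0r add0r.
have s_rees x : x \in s -> x \in rees_ideal u.
  rewrite inE mem_cat !inE => /or4P[/eqP->|/mapP[i]|/eqP->|/eqP->].
  - by apply/eqP; apply: rees_pencil.
  - by rewrite mem_iota => /andP[_ ik] ->; case: (spec i ik).
  - exact/syz_form_rees.
  - exact/syz_form_rees.
apply: minimal_generators_of_indep => [x|]; last first.
  apply: (gens_indep hdk k_gt1 E0 hF bpq hp hq c0) => i ik; by case: (spec i ik).
split=> [rx|/in_spanP]; last exact: span_in_rees.
have hPs i : (i < k)%N ->
    [/\ Thomog i (P i), P i \in rees_ideal u & evalT F (P i) = c *: E].
  by move=> ik; have [[_ hT] ? ?] := spec i ik.
apply/in_spanP.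
exact: (rees_in_span hdk k_gt1 hu hE irE uE hF hFu bpq hp hq c0 hPs sD sP s_p s_q rx).
Qed.
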